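(* Let $F:B_{\ell_2^d}\to\mathbb{R}^n$ be smooth, where $B_{\ell_2^d}$ is the closed unit Euclidean ball of $\mathbb{R}^d$, and suppose there is a constant $c_0\ge1$ with $c_0^{-1}\|x-y\|_2\le\|F(x)-F(y)\|_2\le c_0\|x-y\|_2$ and $\|DF(x)-DF(y)\|_{\ell_2^d\to\ell_2^n}\le c_0\|x-y\|_2$ for all $x,y\in B_{\ell_2^d}$. Let $\mathcal{M}=F(B_{\ell_2^d})$, let $\varepsilon\in(0,1/2)$, and let $\Phi\in\mathbb{R}^{m\times n}$ be the SJLT with column sparsity $s$. There are constants $C,c>0$ (depending only on $c_0$) such that if $m\ge Cd(\log n)^2$ and $s\ge C(\log n)^2$, then with probability at least $1-e^{-cs}$ the following holds: if $1-\varepsilon\le\|\Phi v\|_2\le1+\varepsilon$ for every unit tangent vector $v$ of $\mathcal{M}$, then $\Phi$ preserves geodesic distances up to factor $1+\varepsilon$, i.e., for all $x,y\in\mathcal{M}$, $$(1-\varepsilon)\rho_{\mathcal{M}}(x,y)\le\rho_{\Phi(\mathcal{M})}(\Phi x,\Phi y)\le(1+\varepsilon)\rho_{\mathcal{M}}(x,y).$$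
   Context: The tangent space of $\mathcal{M}$ at $F(u)$ is $DF(u)(\mathbb{R}^d)$; a unit tangent vector is a unit vector in some tangent space. For a set $\mathcal{N}\subset\mathbb{R}^n$ (here $\mathcal{M}$ or $\Phi(\mathcal{M})\subset\mathbb{R}^m$), $\rho_{\mathcal{N}}(a,b)$ is the geodesic distance: the infimum of the lengths of $C^1$ curves in $\mathcal{N}$ joining $a$ and $b$. SJLT with column sparsity $s$: $\Phi_{ij}=s^{-1/2}\sigma_{ij}\delta_{ij}$ with $(\sigma_{ij})$ independent Rademachers, $(\delta_{ij})\in\{0,1\}$ independent of $\sigma$, each column has exactly $s$ ones, for fixed $j$ and distinct $i_1,\dots,i_k$: $\mathbb{E}\prod_t\delta_{i_tj}\le(s/m)^k$, and columns independent across $j$. *)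

(* Defs.v *)
From HB Require Import structures.
From mathcomp Require Export all_boot all_order all_algebra.
From mathcomp Require Export all_classical all_reals all_analysis.

Set Implicit Arguments.
Unset Strict Implicit.
Unset Printing Implicit Defensive.

Export Order.TTheory GRing.Theory Num.Theory.
Export numFieldNormedType.Exports.

#[export] Set Implicit Arguments.
#[export] Unset Strict Implicit.
#[export] Unset Printing Implicit Defensive.

#[global] Open Scope classical_set_scope.
#[global] Open Scope ring_scope.

Section EuclideanNorm.
Context {R : realType}.

(* The library norm on 'cV[R]_n is the sup norm; it induces the same topology
   and the same differentials as the Euclidean one. *)
Definition l2norm (n : nat) (x : 'cV[R]_n) : R :=
  Num.sqrt (\sum_(i < n) x i 0 ^+ 2).

Definition l2ball d : set 'cV[R]_d := [set x | l2norm x <= 1].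

(* Only used on linear maps, for which the supremum is over a nonempty bounded
   set. *)
Definition l2opnorm (d n : nat) (f : 'cV[R]_d -> 'cV[R]_n) : R :=
  sup [set l2norm (f v) | v in @l2ball d].

End EuclideanNorm.

Arguments l2ball : clear implicits.

Section Smoothness.
Context {R : realType} {V W : normedModType R}.

(* For U open and V finite dimensional, this is the class C^k on U. *)
Fixpoint Ck_on (k : nat) (U : set V) (f : V -> W) : Prop :=
  if k is k'.+1 then
    (forall x, U x -> differentiable f x) /\
    (forall v : V, Ck_on k' U ('D_v f))
  else forall x, U x -> {for x, continuous f}.

(* Regularity on a set that need not be open (a closed ball, a compact
   interval) is regularity on some open neighbourhood of it. *)
Definition C1_on (A : set V) (f : V -> W) : Prop :=
  exists U : set V, [/\ open U, A `<=` U & Ck_on 1 U f].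

Definition smooth_on (A : set V) (f : V -> W) : Prop :=
  exists U : set V, [/\ open U, A `<=` U & forall k, Ck_on k U f].

End Smoothness.

Section Geometry.
Context {R : realType}.

Definition unit_itv : set R := `[0%R, 1%R]%classic.

Definition C1_curve_in (n : nat) (N : set 'cV[R]_n) (a b : 'cV[R]_n)
    (g : R -> 'cV[R]_n) : Prop :=
  [/\ C1_on unit_itv g, g @` unit_itv `<=` N,
      g 0 = a & g 1 = b].

Definition curve_length (n : nat) (g : R -> 'cV[R]_n) : \bar R :=
  (\int[lebesgue_measure]_(t in unit_itv)
     (l2norm (derive1 g t))%:E)%E.

(* +oo when no C^1 curve in N joins a and b *)
Definition geodesic_dist (n : nat) (N : set 'cV[R]_n) (a b : 'cV[R]_n)
    : \bar R :=
  ereal_inf [set curve_length g | g in C1_curve_in N a b].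

Definition tangent_space (d n : nat) (F : 'cV[R]_d -> 'cV[R]_n)
    (u : 'cV[R]_d) : set 'cV[R]_n :=
  range ('d F u).

Definition unit_tangent (d n : nat) (F : 'cV[R]_d -> 'cV[R]_n)
    : set 'cV[R]_n :=
  [set v | l2norm v = 1 /\ exists2 u, l2ball R d u & tangent_space F u v].

End Geometry.

Section Independence.
Context {R : realType} {disp : measure_display} {T : measurableType disp}.
Variable P : probability T R.

Definition sigma_algebra_of (I : Type) (X : I -> T -> R) : set (set T) :=
  <<s \bigcup_i preimage_set_system [set: T] (X i) measurable >>.

Definition independent2 (G H : set (set T)) : Prop :=
  forall A B : set T, G A -> H B -> P (A `&` B) = (P A * P B)%E.

Definition mutually_independent (I : finType) (G : I -> set (set T)) : Prop :=
  forall (J : {set I}) (A : I -> set T),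
    (forall i, i \in J -> G i (A i)) ->
    P (\bigcap_(i in [set` J]) A i) = (\prod_(i in J) P (A i))%E.

Definition rademacher (X : T -> R) : Prop :=
  [/\ forall w, X w = 1 \/ X w = -1,
      P [set w | X w = 1] = (2^-1)%:E & P [set w | X w = -1] = (2^-1)%:E].

End Independence.

Section SJLT.
Context {R : realType} {disp : measure_display} {T : measurableType disp}.
Variable P : probability T R.

Record sjlt_factors (m n s : nat) (sigma delta : 'I_m -> 'I_n -> {RV P >-> R})
    : Prop := SjltFactors {
  sigma_rademacher : forall i j, rademacher P (sigma i j) ;
  sigma_indep : mutually_independent P
    (fun ij : 'I_m * 'I_n => sigma_algebra_of (fun _ : unit => sigma ij.1 ij.2)) ;
  delta_01 : forall i j w, delta i j w = 0 \/ delta i j w = 1 ;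
  sigma_delta_indep : independent2 P
    (sigma_algebra_of (fun ij : 'I_m * 'I_n => sigma ij.1 ij.2))
    (sigma_algebra_of (fun ij : 'I_m * 'I_n => delta ij.1 ij.2)) ;
  delta_column_sparsity : forall j w, #|[set i | delta i j w == 1]%SET| = s ;
  (* the set I stands for the k = #|I| distinct row indices i_1, ..., i_k *)
  delta_moment : forall j (I : {set 'I_m}),
    ('E_P[fun w => (\prod_(i in I) delta i j w)%R]
       <= ((s%:R / m%:R) ^+ #|I|)%:E)%E ;
  delta_columns_indep : mutually_independent P
    (fun j : 'I_n => sigma_algebra_of (fun i : 'I_m => delta i j)) }.

Definition sjlt (m n s : nat) (Phi : T -> 'M[R]_(m, n)) : Prop :=
  exists sigma delta : 'I_m -> 'I_n -> {RV P >-> R},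
    sjlt_factors s sigma delta /\
    forall w i j, Phi w i j = (Num.sqrt s%:R)^-1 * sigma i j w * delta i j w.

End SJLT.

(* Main.v *)
Require Import Defs.
From mathcomp Require Import ring lra zify measurable_realfun.

(** A [C^1] curve in the image of the ball under an expansive [C^1] map lifts to a
    [C^1] curve in the ball, so the tangent hypothesis compares lengths in both
    directions as soon as [Phi] is expansive on the manifold. For chords of length
    at most [1/(4 c0^2 n)] this follows from the tangent hypothesis and Taylor's
    formula, because the columns of [Phi] are unit vectors.

    For longer chords only a crude lower bound on [Phi v] is needed. Scale the
    chord [v] to sup norm 1 and let [N_j] be the number of coordinates of size at
    least [(n+1)^-j]. Either [N_j >= 2^j] and [N_(j+1) < 2^(j+1)] for some [j] with
    [2^j < d], and then [v] rounds to an integer vector with fewer than [2^(j+1)]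
    nonzero coordinates, or [v] has at least [d] coordinates of size
    [n^(-O(log n))], and then a net of the ball is fine enough. At scale [k] the
    union has [exp (O (k (log n)^2))] members. A vector with [k] large coordinates
    is small on all rows with probability at most [2 * 2^-l], where [l] is of order
    [min (s k, m)]: these [k] columns meet more than [l] rows except with
    probability [2^-l], and each row they meet is large for one of the two values
    of a sign. *)

(** * Euclidean norm *)

Section EuclideanNormTheory.
Context {R : realType}.

Lemma l2norm_ge0 n (x : 'cV[R]_n) : 0 <= l2norm x.
Proof. exact: sqrtr_ge0. Qed.

Lemma sqr_l2norm n (x : 'cV[R]_n) : l2norm x ^+ 2 = \sum_i x i 0 ^+ 2.
Proof. by rewrite sqr_sqrtr// sumr_ge0// => i _; exact: sqr_ge0. Qed.

Lemma l2norm_le n (x : 'cV[R]_n) a :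
  0 <= a -> \sum_i x i 0 ^+ 2 <= a ^+ 2 -> l2norm x <= a.
Proof. by move=> a0; rewrite -sqr_l2norm ler_pXn2r// nnegrE ?l2norm_ge0. Qed.

Lemma ler_coord_l2norm n (x : 'cV[R]_n) i : `|x i 0| <= l2norm x.
Proof.
rewrite -sqrtr_sqr /l2norm ler_wsqrtr// (bigD1 i)//= lerDl sumr_ge0// => j _.
exact: sqr_ge0.
Qed.

Lemma l2norm_eq0 n (x : 'cV[R]_n) : (l2norm x == 0) = (x == 0).
Proof.
apply/eqP/eqP => [x0|->].
  apply/colP => i; rewrite mxE; apply/eqP; rewrite -normr_eq0 eq_le normr_ge0.
  by rewrite -x0 ler_coord_l2norm.
by rewrite /l2norm big1 ?sqrtr0// => i _; rewrite mxE expr0n.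
Qed.

Lemma l2norm0 n : l2norm (0 : 'cV[R]_n) = 0.
Proof. by apply/eqP; rewrite l2norm_eq0. Qed.

Lemma l2norm_gt0 n (x : 'cV[R]_n) : (0 < l2norm x) = (x != 0).
Proof. by rewrite lt_def l2norm_ge0 l2norm_eq0 andbT. Qed.

Lemma l2norm_le0 n (x : 'cV[R]_n) : (l2norm x <= 0) = (x == 0).
Proof. by rewrite leNgt l2norm_gt0 negbK. Qed.

Lemma l2normZ n a (x : 'cV[R]_n) : l2norm (a *: x) = `|a| * l2norm x.
Proof.
rewrite /l2norm -sqrtr_sqr -sqrtrM ?sqr_ge0// mulr_sumr.
by congr Num.sqrt; apply: eq_bigr => i _; rewrite mxE exprMn.
Qed.

Lemma l2normN n (x : 'cV[R]_n) : l2norm (- x) = l2norm x.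
Proof. by rewrite -scaleN1r l2normZ normrN1 mul1r. Qed.

Lemma l2norm_normalize n (x : 'cV[R]_n) :
  x != 0 -> l2norm ((l2norm x)^-1 *: x) = 1.
Proof.
by move=> x0; rewrite l2normZ gtr0_norm ?invr_gt0 ?l2norm_gt0// mulVf ?l2norm_eq0.
Qed.

Lemma l2norm_cauchy_schwarz n (x y : 'cV[R]_n) :
  \sum_i x i 0 * y i 0 <= l2norm x * l2norm y.
Proof.
have [->|x0] := eqVneq x 0.
  by rewrite l2norm0 mul0r big1// => i _; rewrite mxE mul0r.
have [->|y0] := eqVneq y 0.
  by rewrite l2norm0 mulr0 big1// => i _; rewrite mxE mulr0.
rewrite -l2norm_gt0 in x0; rewrite -l2norm_gt0 in y0.
set D := \sum_i _.
have : 0 <= \sum_i (l2norm y * x i 0 - l2norm x * y i 0) ^+ 2.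
  by apply: sumr_ge0 => i _; exact: sqr_ge0.
have -> : \sum_i (l2norm y * x i 0 - l2norm x * y i 0) ^+ 2 =
    l2norm y ^+ 2 * (\sum_i x i 0 ^+ 2) + l2norm x ^+ 2 * (\sum_i y i 0 ^+ 2) -
    2 * l2norm x * l2norm y * D.
  rewrite !mulr_sumr -big_split -sumrB.
  by apply: eq_bigr => i _ /=; ring.
rewrite -!sqr_l2norm.
have -> : l2norm y ^+ 2 * l2norm x ^+ 2 + l2norm x ^+ 2 * l2norm y ^+ 2 -
    2 * l2norm x * l2norm y * D =
  2 * (l2norm x * l2norm y) * (l2norm x * l2norm y - D) by ring.
by rewrite pmulr_rge0 ?subr_ge0// !mulr_gt0.
Qed.

Lemma ler_l2normD n (x y : 'cV[R]_n) : l2norm (x + y) <= l2norm x + l2norm y.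
Proof.
apply: l2norm_le; first by rewrite addr_ge0 ?l2norm_ge0.
have -> : \sum_i (x + y) i 0 ^+ 2 =
    l2norm x ^+ 2 + l2norm y ^+ 2 + 2 * \sum_i x i 0 * y i 0.
  rewrite !sqr_l2norm mulr_sumr -!big_split.
  by apply: eq_bigr => i _; rewrite mxE /=; ring.
have := l2norm_cauchy_schwarz x y; lra.
Qed.

Lemma ler_l2norm_sum n (I : Type) (r : seq I) (f : I -> 'cV[R]_n) :
  l2norm (\sum_(i <- r) f i) <= \sum_(i <- r) l2norm (f i).
Proof.
elim/big_ind2: _ => [|x a y b xa yb|//]; first by rewrite l2norm0.
exact: le_trans (ler_l2normD _ _) (lerD xa yb).
Qed.

Lemma ler_l2normB n (x y : 'cV[R]_n) : l2norm (x - y) <= l2norm x + l2norm y.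
Proof. by rewrite -[l2norm y]l2normN ler_l2normD. Qed.

Lemma lerB_l2dist n (x y : 'cV[R]_n) : l2norm x - l2norm y <= l2norm (x - y).
Proof. by rewrite lerBlDr -{1}(subrK y x) ler_l2normD. Qed.

Lemma l2norm_le_coord n (x : 'cV[R]_n) a :
  (forall i, `|x i 0| <= a) -> l2norm x <= n%:R * a.
Proof.
move=> xa; rewrite [x]matrix_sum_delta.
under eq_bigr do rewrite big_ord1.
apply: (le_trans (ler_l2norm_sum _ _)).
rewrite mulr_natl -[n in _ *+ n]card_ord -sumr_const.
apply: ler_sum => i _; rewrite l2normZ -[leRHS]mulr1 ler_pM ?l2norm_ge0//.
apply: l2norm_le => //; rewrite (bigD1 i)//= big1 ?addr0 => [|j ji].
  by rewrite mxE !eqxx.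
by rewrite mxE (negbTE ji)/= expr0n.
Qed.

Lemma ler_coord_norm n (x : 'cV[R]_n) i : `|x i 0| <= `|x|.
Proof.
by rewrite [leRHS]/Num.norm/= mx_normrE; apply: le_trans (le_bigmax _ _ (i, 0)).
Qed.

Lemma exists_coord_norm n (x : 'cV[R]_n) : x != 0 -> exists i, `|x i 0| = `|x|.
Proof.
rewrite -normr_eq0 => /mx_norm_neq0[[i j] xij]; exists i.
by rewrite [RHS]xij (ord1 j).
Qed.

Lemma ler_mx_l2norm n (x : 'cV[R]_n) : `|x| <= l2norm x.
Proof.
rewrite /Num.norm/= mx_normrE; apply/bigmax_leP; split; first exact: l2norm_ge0.
by move=> [i j] _ /=; rewrite (ord1 j) ler_coord_l2norm.
Qed.

Lemma ler_l2norm_mx n (x : 'cV[R]_n) : l2norm x <= n%:R * `|x|.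
Proof. by apply: l2norm_le_coord => i; exact: ler_coord_norm. Qed.

Lemma ler_l2norm_linear d n (f : {linear 'cV[R]_d -> 'cV[R]_n}) v :
  l2norm (f v) <= (\sum_j l2norm (f (delta_mx j 0))) * l2norm v.
Proof.
rewrite {1}[v]matrix_sum_delta linear_sum.
apply: (le_trans (ler_l2norm_sum _ _)).
rewrite mulr_suml; apply: ler_sum => j _.
by rewrite big_ord1 linearZ l2normZ mulrC ler_wpM2l ?l2norm_ge0 ?ler_coord_l2norm.
Qed.

Lemma ler_l2norm_mulmx d n (A : 'M[R]_(n, d)) v :
  l2norm (A *m v) <= (\sum_j l2norm (col j A)) * l2norm v.
Proof.
apply: le_trans (ler_l2norm_linear (mulmx A) v) _.
by under eq_bigr do rewrite /= -colE.
Qed.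

Lemma ler_l2norm_opnorm d n (f : {linear 'cV[R]_d -> 'cV[R]_n}) v :
  l2norm (f v) <= l2opnorm f * l2norm v.
Proof.
have [->|v0] := eqVneq v 0; first by rewrite linear0 !l2norm0 mulr0.
rewrite -ler_pdivrMr ?l2norm_gt0//.
have -> : l2norm (f v) / l2norm v = l2norm (f ((l2norm v)^-1 *: v)).
  by rewrite linearZ l2normZ gtr0_norm ?invr_gt0 ?l2norm_gt0// mulrC.
apply: ub_le_sup; last first.
  by exists ((l2norm v)^-1 *: v) => //; rewrite /l2ball/= l2norm_normalize.
exists (\sum_j l2norm (f (delta_mx j 0))) => _ [w w1 <-].
apply: le_trans (ler_l2norm_linear f w) _.
by rewrite ler_piMr// sumr_ge0// => j _; exact: l2norm_ge0.
Qed.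

Lemma continuous_l2norm n : continuous (@l2norm R n).
Proof.
have sum_cts : continuous (fun x : 'cV[R]_n => \sum_i x i 0 ^+ 2).
  apply: (continuous_big (op := +%R)) => [|i _ x]; first exact: add_continuous.
  apply: (@continuous_comp _ _ _ (fun x : 'cV[R]_n => x i 0) (fun a => a ^+ 2)).
    exact: coord_continuous.
  exact: exprn_continuous.
move=> x; apply: (@continuous_comp _ _ _ _ (@Num.sqrt R)); first exact: sum_cts.
exact: sqrt_continuous.
Qed.

Section L2Convergence.
Context {T : Type} {F : set_system T} {FF : Filter F} {n : nat}.
Implicit Types (f : T -> 'cV[R]_n) (l : 'cV[R]_n).

Lemma cvg_l2dist f l : f x @[x --> F] --> l -> l2norm (f x - l) @[x --> F] --> 0.
Proof.
move=> /subr_cvg0 fl; rewrite -(@l2norm0 n).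
exact: continuous_cvg (@continuous_l2norm n 0) fl.
Qed.

Lemma squeeze_l2dist f l (g : T -> R) C :
  (\forall x \near F, l2norm (f x - l) <= C * g x) ->
  g x @[x --> F] --> 0 -> f x @[x --> F] --> l.
Proof.
move=> fg g0; have : C * g x @[x --> F] --> 0.
  by rewrite -(mulr0 C); exact: cvgMl_tmp.
move=> /cvgr0_norm_le Cg0; apply/subr_cvg0/cvgr0Pnorm_le => e /Cg0.
apply: filterS2 fg => x fgx Cgx; apply: le_trans (ler_mx_l2norm _) _.
exact: le_trans fgx (le_trans (ler_norm _) Cgx).
Qed.

End L2Convergence.

Lemma linear_continuous_cV d n (f : {linear 'cV[R]_d -> 'cV[R]_n}) : continuous f.
Proof.
move=> x; apply: (squeeze_l2dist (F := nbhs x) (g := fun y => l2norm (y - x))).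
  by apply: nearW => y; rewrite -linearB; exact: ler_l2norm_linear.
exact: cvg_l2dist.
Qed.

Lemma l2ball_convex d (x y : 'cV[R]_d) t : l2ball R d x -> l2ball R d y ->
  0 <= t <= 1 -> l2ball R d (x + t *: (y - x)).
Proof.
rewrite /l2ball/= => x1 y1 /andP[t0 t1].
have -> : x + t *: (y - x) = (1 - t) *: x + t *: y.
  by rewrite scalerBr scalerBl scale1r addrCA addrA -addrA addrC.
rewrite (le_trans (ler_l2normD _ _))// !l2normZ !ger0_norm ?subr_ge0//.
by rewrite -[leRHS](subrK t) lerD// ler_piMr// subr_ge0.
Qed.

End EuclideanNormTheory.

(** * Functions of class C1 *)

Section C1Functions.
Context {R : realType}.

Lemma C1_on_differentiable (V W : normedModType R) (A : set V) (f : V -> W) x :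
  C1_on A f -> A x -> differentiable f x.
Proof. by move=> [U [_ AU [df _]]] /AU/df. Qed.

Lemma C1_on_continuous_derive (V W : normedModType R) (A : set V) (f : V -> W) v x :
  C1_on A f -> A x -> {for x, continuous ('D_v f)}.
Proof. by move=> [U [_ AU [_ cf]]] /AU; exact: cf. Qed.

Lemma diff_remainder_le (V W : normedModType R) (f : V -> W) x e : 0 < e ->
  differentiable f x ->
  \forall y \near x, `|f y - f x - 'd f x (y - x)| <= e * `|y - x|.
Proof.
move=> e0 /diff_locally/eqaddoP/(_ e e0) dfx; apply/nbhs0P.
by apply: filterS dfx => v; rewrite [x + v]addrC addrK -addrA -opprD.
Qed.

Lemma smooth_on_C1 (V W : normedModType R) (A : set V) (f : V -> W) :
  smooth_on A f -> C1_on A f.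
Proof. by move=> [U [oU AU kf]]; exists U; split => //; exact: kf. Qed.

Lemma C1_on_linear d n (f : {linear 'cV[R]_d -> 'cV[R]_n}) A : C1_on A f.
Proof.
have df x : differentiable f x.
  by apply: linear_differentiable; exact: linear_continuous_cV.
exists setT; split => //; first exact: openT.
split=> [x _|v]; first exact: df.
have -> : 'D_v f = cst (f v).
  apply/funext => x; rewrite deriveE// diff_lin//; exact: linear_continuous_cV.
by move=> x _; exact: cst_continuous.
Qed.

Lemma diff_cV_sum d (W : normedModType R) (f : 'cV[R]_d -> W) x v :
  'd f x v = \sum_j v j 0 *: 'd f x (delta_mx j 0).
Proof.
rewrite {1}[v]matrix_sum_delta linear_sum; apply: eq_bigr => j _.
by rewrite big_ord1 linearZ.
Qed.

Lemma C1_on_comp d (V W : normedModType R) (A : set V) (B : set 'cV[R]_d)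
    (g : V -> 'cV[R]_d) (f : 'cV[R]_d -> W) :
  C1_on A g -> (forall x, A x -> B (g x)) -> C1_on B f -> C1_on A (f \o g).
Proof.
move=> [Ug [oUg AUg [dg cg]]] AB [Uf [oUf BUf [df cf]]].
have dfg x : Ug x -> Uf (g x) -> differentiable (f \o g) x.
  by move=> /dg ? /df ?; exact: differentiable_comp.
have nearU x : Ug x -> Uf (g x) -> \forall y \near x, Ug y /\ Uf (g y).
  move=> Ugx Ufgx; apply: filterI; first exact: open_nbhs_nbhs.
  by apply: (differentiable_continuous (dg x Ugx)); exact: open_nbhs_nbhs.
exists (Ug `&` g @^-1` Uf); split.
- by rewrite openE => x [] /nearU /[apply].
- by move=> x Ax; split; [exact: AUg|exact/BUf/AB].
split=> [x []|v x [Ugx Ufgx]]; first exact: dfg.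
have derive_comp y : Ug y -> Uf (g y) ->
    'D_v (f \o g) y = \sum_j ('D_v g y) j 0 *: 'D_(delta_mx j 0) f (g y).
  move=> Ugy Ufgy; have [dgy dfgy] := (dg y Ugy, df _ Ufgy).
  rewrite (deriveE v (dfg y Ugy Ufgy)) (diff_comp dgy dfgy) /= -(deriveE v dgy).
  by rewrite diff_cV_sum; apply: eq_bigr => j _; rewrite (deriveE _ dfgy).
apply: cvg_trans.
  apply: near_eq_cvg; apply: filterS (nearU x Ugx Ufgx) => y [Ugy Ufgy].
  exact/esym/derive_comp.
rewrite derive_comp//; apply: cvg_big => [|j _]; first exact: add_continuous.
apply: cvgZ.
  exact: (continuous_cvg _ (@coord_continuous _ _ _ j 0 _) (cg v x Ugx)).
exact: (continuous_cvg _ (cf _ _ Ufgx) (differentiable_continuous (dg x Ugx))).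
Qed.

Lemma C1_on_mulmx m n (V : normedModType R) (A : set V) (Phi : 'M[R]_(m, n))
    (g : V -> 'cV[R]_n) : C1_on A g -> C1_on A (fun x => Phi *m g x).
Proof.
move=> Cg.
exact: (C1_on_comp (B := setT) Cg (fun _ _ => I) (C1_on_linear (mulmx Phi) _)).
Qed.

Lemma derive_comp_cV d (V W : normedModType R) (A : set V) (B : set 'cV[R]_d)
    (g : V -> 'cV[R]_d) (f : 'cV[R]_d -> W) v x :
  C1_on A g -> (forall x, A x -> B (g x)) -> C1_on B f -> A x ->
  'D_v (f \o g) x = 'd f (g x) ('D_v g x).
Proof.
move=> Cg AB Cf Ax; have dg := C1_on_differentiable Cg Ax.
have df := C1_on_differentiable Cf (AB x Ax).
rewrite (deriveE v (differentiable_comp dg df)) (diff_comp dg df) /=.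
by rewrite (deriveE v dg).
Qed.

End C1Functions.

(** * Curves on the unit interval *)

Section CurvesOnUnitInterval.
Context {R : realType}.
Local Notation I01 := (@unit_itv R).

Lemma unit_itvP (t : R) : I01 t <-> 0 <= t <= 1.
Proof. by rewrite /unit_itv/= in_itv. Qed.

Section OneSidedDerivatives.
Context {V : normedModType R}.
Implicit Types (g : R -> V) (t r : R) (D : set R).

Definition slope g t r : V := (r - t)^-1 *: (g r - g t).

Lemma is_derive1P g t v : is_derive t 1 g v <-> slope g t r @[r --> t^'] --> v.
Proof.
pose quot h := h^-1 *: ((g \o shift t) (h *: 1) - g t).
have slope_shift h : slope g t (t + h) = quot h.
  by rewrite /slope /quot /= [_%:A]mulr1 addrAC subrr add0r [h + t]addrC.
suff -> : slope g t r @[r --> t^'] --> v <-> quot h @[h --> 0^'] --> v.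
  split=> [[dg dgE]|gv]; first by rewrite -dgE.
  by split; [apply/cvg_ex; exists v|exact: cvg_lim].
split=> /cvgrPdist_le gv; apply/cvgrPdist_le => e /gv; rewrite !near_withinE.
  move=> /nbhs0P; apply: filterS => h; rewrite slope_shift => + h0; apply.
  by rewrite addrC -subr_eq0 addrK.
move=> qv; apply: (nbhs0P (fun r => r != t -> `|v - slope g t r| <= e) t).2.
apply: filterS qv => h + th; rewrite slope_shift; apply.
by move: th; rewrite addrC -subr_eq0 addrK.
Qed.

Definition C1_within D g g' : Prop := forall t, D t ->
  slope g t r @[r --> within (D `\ t) (nbhs t)] --> g' t /\
  g' r @[r --> within D (nbhs t)] --> g' t.

Lemma C1_on_within D g : C1_on D g -> C1_within D g (derive1 g).
Proof.
move=> Cg t Dt; split.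
  have dg : derivable g t 1.
    exact/diff_derivable/(C1_on_differentiable Cg).
  have /is_derive1P := derivableP dg; rewrite -derive1E; apply: cvg_trans.
  apply: cvg_app; rewrite /dnbhs.
  by apply: (@within_subset _ _ _ (nbhs t)) => r [_ /eqP].
have -> : derive1 g = 'D_1 g by apply/funext => r; rewrite derive1E.
exact: cvg_within_filter (C1_on_continuous_derive Cg Dt).
Qed.

Lemma unit_itv_limit_point t : I01 t -> ProperFilter (within (I01 `\ t) (nbhs t)).
Proof.
move=> /unit_itvP /andP[t0 t1]; apply: within_nbhs_proper => A /nbhs_ballP[e /= e0 eA].
pose z := Num.min (e / 2) 2^-1.
have z0 : 0 < z by rewrite lt_min divr_gt0/= ?invr_gt0.
have ze : z < e by rewrite gt_min ltr_pdivrMr// ltr_pMr// ltr1n.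
have z2 : z <= 2^-1 by rewrite ge_min lexx orbT.
have [t2|t2] := leP t 2^-1.
  exists (t + z); split; last first.
    by apply: eA; rewrite /ball/= opprD addNKr normrN gtr0_norm.
  split; first by apply/unit_itvP; lra.
  by move=> /= tz; lra.
exists (t - z); split; last by apply: eA; rewrite /ball/= opprB addrC subrK gtr0_norm.
split; first by apply/unit_itvP; lra.
by move=> /= tz; lra.
Qed.

Lemma C1_within_unique g1 g2 g1' g2' :
  C1_within I01 g1 g1' -> C1_within I01 g2 g2' ->
  {in I01, g1 =1 g2} -> {in I01, g1' =1 g2'}.
Proof.
move=> Cg1 Cg2 g12 t tI; have /set_mem It := tI.
have [[slope1 _] [slope2 _]] := (Cg1 t It, Cg2 t It).
have FP := unit_itv_limit_point It.
apply: cvg_unique slope1 _; first exact: norm_hausdorff.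
apply: cvg_trans slope2; apply: fmap_within_eq => r /set_mem [Ir _].
by rewrite /slope !g12//; exact/mem_set.
Qed.

Definition clamp t : R := Num.max 0 (Num.min t 1).

Lemma clamp_id t : I01 t -> clamp t = t.
Proof.
by move=> /unit_itvP/andP[t0 t1]; rewrite /clamp (min_idPl t1) (max_idPr t0).
Qed.

Lemma clamp_le0 t : t <= 0 -> clamp t = 0.
Proof. by move=> t0; rewrite /clamp (min_idPl _) ?max_l// (le_trans t0). Qed.

Lemma clamp_ge1 t : 1 <= t -> clamp t = 1.
Proof. by move=> t1; rewrite /clamp (min_idPr t1) (max_idPr _). Qed.

Lemma near_clamp t : \forall r \near t, (I01 t /\ I01 r) \/ clamp r = clamp t.
Proof.
have near_lt a : \forall r \near t, t < a -> r < a.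
  by have [ta|_] := ltP t a; [near=> r => _; near: r; exact: lt_nbhsl|by near=> r].
have near_gt a : \forall r \near t, a < t -> a < r.
  by have [ta|_] := ltP a t; [near=> r => _; near: r; exact: lt_nbhsr|by near=> r].
near=> r; have r_lt1 : t < 1 -> r < 1 by near: r; exact: near_lt.
have r_gt0 : 0 < t -> 0 < r by near: r; exact: near_gt.
have r_lt0 : t < 0 -> r < 0 by near: r; exact: near_lt.
have r_gt1 : 1 < t -> 1 < r by near: r; exact: near_gt.
have [t0|t0] := ltP t 0; first by right; rewrite !clamp_le0// ltW ?r_lt0.
have [t1|t1] := ltP 1 t; first by right; rewrite !clamp_ge1// ltW ?r_gt1.
have [r0|r0] := ltP r 0.
  by right; rewrite !clamp_le0 ?(ltW r0)// leNgt; apply/negP => /r_gt0; lra.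
have [r1|r1] := ltP 1 r.
  by right; rewrite !clamp_ge1 ?(ltW r1)// leNgt; apply/negP => /r_lt1; lra.
by left; split; apply/unit_itvP; apply/andP.
Unshelve. all: by end_near. Qed.

Section TangentExtension.
Variables g g' : R -> V.
Hypothesis C1g : C1_within I01 g g'.

(* Beyond an endpoint the curve is continued along its tangent line. *)
Definition tangent_extension t : V := g (clamp t) + (t - clamp t) *: g' (clamp t).

Lemma tangent_extension_id t : I01 t -> tangent_extension t = g t.
Proof. by move=> It; rewrite /tangent_extension clamp_id// subrr scale0r addr0. Qed.

Lemma slope_tangent_extension t r : r != t -> clamp r = clamp t ->
  slope tangent_extension t r = g' (clamp t).
Proof.
move=> rt rtE; rewrite /slope /tangent_extension rtE opprD addrACA subrr add0r.
by rewrite -scalerBl opprB addrA subrK scalerA mulVf ?scale1r// subr_eq0.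
Qed.

Lemma is_derive_tangent_extension t :
  is_derive t 1 tangent_extension (g' (clamp t)).
Proof.
apply/is_derive1P/cvgrPdist_le => e e0.
have [It|nIt] := pselect (I01 t); last first.
  rewrite near_withinE; apply: filterS (near_clamp t) => r + rt.
  by case=> [[]//|/(slope_tangent_extension rt) ->]; rewrite subrr normr0 ltW.
have [/cvgrPdist_le/(_ e e0) + _] := C1g It; rewrite !near_withinE.
apply: filterS2 (near_clamp t) => r [[_ Ir]|/[swap] _]; last first.
  by move=> /slope_tangent_extension + rt => ->//; rewrite subrr normr0 ltW.
move=> + rt; rewrite clamp_id// /slope !tangent_extension_id//; apply; split => //.
exact/eqP.
Qed.

Lemma clamped_derivative_continuous : continuous (g' \o clamp).
Proof.
move=> t; apply/cvgrPdist_le => e e0 /=.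
have [It|nIt] := pselect (I01 t); last first.
  by apply: filterS (near_clamp t) => r [[]//|->]; rewrite subrr normr0 ltW.
have [_ /cvgrPdist_le/(_ e e0)] := C1g It; rewrite near_withinE clamp_id//.
apply: filterS2 (near_clamp t) => r [[_ Ir] /(_ Ir)|-> _]; first by rewrite clamp_id.
by rewrite clamp_id// subrr normr0 ltW.
Qed.

Lemma C1_within_extend :
  exists2 gx, C1_on I01 gx & forall t, I01 t -> gx t = g t /\ derive1 gx t = g' t.
Proof.
have gx_derive1 : derive1 tangent_extension = g' \o clamp.
  by apply/funext => t; rewrite derive1E; have [_ ->] := is_derive_tangent_extension t.
exists tangent_extension => [|t It]; last first.
  by rewrite gx_derive1 /= clamp_id// tangent_extension_id.
have gx_diff t : differentiable tangent_extension t.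
  by apply/derivable1_diffP; have [] := is_derive_tangent_extension t.
exists setT; split => //; [exact: openT|split=> [t _|v t _]; first exact: gx_diff].
have -> : 'D_v tangent_extension = (fun t => v *: (g' \o clamp) t).
  by apply/funext => r; rewrite deriveE// diff1E// gx_derive1.
by apply: cvgZl_tmp; exact: clamped_derivative_continuous.
Qed.

End TangentExtension.

End OneSidedDerivatives.

End CurvesOnUnitInterval.

(** * Expansive maps and lifts of curves *)

Section ExpansiveMaps.
Context {R : realType}.

Definition l2expansive d n (B : set 'cV[R]_d) (c : R) (f : 'cV[R]_d -> 'cV[R]_n) :=
  forall x y, B x -> B y -> c * l2norm (x - y) <= l2norm (f x - f y).

Lemma l2expansive_inj d n (B : set 'cV[R]_d) c (f : 'cV[R]_d -> 'cV[R]_n) x y :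
  0 < c -> l2expansive B c f -> B x -> B y -> f x = f y -> x = y.
Proof.
move=> c0 fc Bx By fxy; apply/eqP; rewrite -subr_eq0 -l2norm_le0 -(pmulr_rle0 _ c0).
by rewrite (le_trans (fc _ _ Bx By))// fxy subrr l2norm0.
Qed.

Lemma l2expansive_diff_interior d n (B : set 'cV[R]_d) c
    (f : 'cV[R]_d -> 'cV[R]_n) x v :
  l2expansive B c f -> differentiable f x -> B° x ->
  c * l2norm v <= l2norm ('d f x v).
Proof.
move=> fc df Bx; rewrite -deriveE//.
have cvg_quot : l2norm (h^-1 *: ((f \o shift x) (h *: v) - f x)) @[h --> 0^'] -->
    l2norm ('D_v f x).
  by apply: continuous_cvg; [exact: continuous_l2norm|exact: diff_derivable].
apply: (cvgr_to_ge cvg_quot).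
have line_cts : h *: v + x @[h --> (0 : R)] --> x.
  rewrite -[X in _ --> X]add0r -[X in X + _](scale0r v).
  by apply: cvgD; [exact: cvgZr_tmp|exact: cvg_cst].
have nearB : \forall h \near 0^', B (h *: v + x).
  exact: nbhs_dnbhs (line_cts _ Bx).
rewrite !near_withinE in nearB *.
apply: filterS nearB => h /[swap] h0 /(_ h0) Bh.
have := fc _ _ Bh (interior_subset Bx); rewrite addrK !l2normZ mulrCA.
by rewrite normfV ler_pdivlMl ?normr_gt0.
Qed.

Lemma l2expansive_diff d n (B : set 'cV[R]_d) c (f : 'cV[R]_d -> 'cV[R]_n) x v :
  B `<=` closure B° -> l2expansive B c f -> C1_on B f -> B x ->
  c * l2norm v <= l2norm ('d f x v).
Proof.
move=> Bint fc Cf Bx.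
have FP : ProperFilter (within B° (nbhs x)) by apply: within_nbhs_proper; exact: Bint.
have cvg_derive : l2norm ('D_v f y) @[y --> within B° (nbhs x)] --> l2norm ('D_v f x).
  apply: continuous_cvg (@continuous_l2norm _ _ _) _.
  exact: cvg_within_filter (C1_on_continuous_derive Cf Bx).
rewrite -deriveE; last exact: C1_on_differentiable Cf Bx.
apply: (cvgr_to_ge cvg_derive); rewrite near_withinE; near=> y => By.
have dfy : differentiable f y.
  exact: (C1_on_differentiable Cf (interior_subset By)).
by rewrite deriveE//; exact: (l2expansive_diff_interior _ fc).
Unshelve. all: by end_near. Qed.

Lemma l2ball_closure_interior d : l2ball R d `<=` closure (l2ball R d)°.
Proof.
move=> x Bx A xA; have shrink_cts : (1 - t) *: x @[t --> (0 : R)^'+] --> x.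
  rewrite -[X in _ --> X]scale1r -[X in X *: _]subr0; apply: cvgZr_tmp.
  by apply: cvgB; [exact: cvg_cst|exact: cvg_at_right_filter].
have [t [At t0 t1]] : exists t : R, [/\ A ((1 - t) *: x), 0 < t & t < 1].
  near (0 : R)^'+ => t; exists t; split; near: t.
  - exact: shrink_cts.
  - exact: nbhs_right_gt.
  - exact: nbhs_right_lt.
exists ((1 - t) *: x); split => //.
have open_lt1 : open [set y : 'cV[R]_d | l2norm y < 1].
  by apply: open_comp (@open_lt _ 1) => y _; exact: continuous_l2norm.
have lt1_interior : [set y | l2norm y < 1] `<=` (l2ball R d)°.
  by rewrite -open_subsetE// => y /ltW.
apply: lt1_interior.
rewrite /= l2normZ ger0_norm ?subr_ge0 ?ltW//.
by rewrite (le_lt_trans (ler_wpM2l _ Bx)) ?subr_ge0 ?mulr1 ?ltrBlDr ?ltrDl// ltW.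
Unshelve. all: by end_near. Qed.

Lemma l2expansive_linear_inj d n (f : {linear 'cV[R]_d -> 'cV[R]_n}) c :
  0 < c -> (forall v, c * l2norm v <= l2norm (f v)) -> lker (linfun f) == 0%VS.
Proof.
move=> c0 fc; apply/lker0P => v w; rewrite !lfunE => fvw.
apply: (l2expansive_inj (B := setT) c0 _ I I fvw) => x y _ _.
by rewrite -linearB.
Qed.

Lemma l2expansive_leq_dim d n (f : {linear 'cV[R]_d -> 'cV[R]_n}) c :
  0 < c -> (forall v, c * l2norm v <= l2norm (f v)) -> (d <= n)%N.
Proof.
move=> c0 /(l2expansive_linear_inj c0) /eqP kf.
have := dimvS (subvf (linfun f @: fullv)).
by rewrite limg_dim_eq ?kf ?capv0// !dimvf /dim/= !muln1.
Qed.

End ExpansiveMaps.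

Section LiftingCurves.
Context {R : realType}.
Variables (d n : nat) (G : 'cV[R]_d -> 'cV[R]_n) (B : set 'cV[R]_d) (c : R).
Hypothesis c_gt0 : 0 < c.
Hypothesis B_regular : B `<=` closure B°.
Hypothesis C1G : C1_on B G.
Hypothesis expG : l2expansive B c G.
Local Notation I01 := (@unit_itv R).

Let expdG x v : B x -> c * l2norm v <= l2norm ('d G x v).
Proof. exact: l2expansive_diff B_regular expG C1G. Qed.

Section Lift.
Variables (h : R -> 'cV[R]_n) (u : R -> 'cV[R]_d).
Hypothesis C1h : C1_on I01 h.
Hypothesis uB : forall t, I01 t -> B (u t).
Hypothesis Gu : forall t, I01 t -> G (u t) = h t.

Lemma lift_continuous t : I01 t -> u r @[r --> within I01 (nbhs t)] --> u t.
Proof.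
move=> It; apply: (squeeze_l2dist (C := c^-1) (g := fun r => l2norm (h r - h t))).
  rewrite near_withinE; apply: nearW => r Ir.
  by rewrite ler_pdivlMl// -!Gu//; apply: expG; exact: uB.
apply: cvg_l2dist; apply: cvg_within_filter.
exact: differentiable_continuous (C1_on_differentiable C1h It).
Qed.

Lemma lift_slope_le t r : I01 t -> I01 r ->
  c * l2norm (slope u t r) <= l2norm (slope h t r).
Proof.
move=> It Ir; rewrite !l2normZ mulrCA ler_wpM2l// -!Gu//.
by apply: expG; exact: uB.
Qed.

Lemma diff_lift_slope t : I01 t ->
  'd G (u t) (slope u t r) @[r --> within (I01 `\ t) (nbhs t)] --> derive1 h t.
Proof.
move=> It; have dG := C1_on_differentiable C1G (uB It).
have [slope_h _] := C1_on_within C1h It.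
pose rem r := slope h t r - 'd G (u t) (slope u t r).
suff rem0 : rem r @[r --> within (I01 `\ t) (nbhs t)] --> 0.
  have -> : (fun r => 'd G (u t) (slope u t r)) = slope h t \- rem.
    by apply/funext => r; rewrite /= subKr.
  by rewrite -[derive1 h t]subr0; exact: cvgB.
apply/cvgr0Pnorm_le => e e0; pose M := 1 + l2norm (derive1 h t).
have M0 : 0 < M by rewrite ltr_pwDl// l2norm_ge0.
have e1 : 0 < e * c / M by rewrite divr_gt0// mulr_gt0.
have near_slope : \forall r \near within (I01 `\ t) (nbhs t), l2norm (slope h t r) <= M.
  apply: (cvgr_le (l2norm (derive1 h t))); last by rewrite ltrDr.
  exact: continuous_cvg (@continuous_l2norm _ _ _) slope_h.
have near_rem : \forall r \near within (I01 `\ t) (nbhs t),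
    `|G (u r) - G (u t) - 'd G (u t) (u r - u t)| <= e * c / M * `|u r - u t|.
  have u_cts : u r @[r --> within (I01 `\ t) (nbhs t)] --> u t.
    apply: cvg_trans (lift_continuous It); apply: cvg_app; apply: within_subset.
    exact: subDsetl.
  exact: u_cts (diff_remainder_le e1 dG).
rewrite !near_withinE in near_slope near_rem *.
apply: filterS2 near_slope near_rem => r slope_r rem_r rD; have [Ir rt] := rD.
have {}slope_r := slope_r rD; have {}rem_r := rem_r rD.
have -> : rem r = (r - t)^-1 *: (G (u r) - G (u t) - 'd G (u t) (u r - u t)).
  by rewrite /rem /slope linearZ -scalerBr !Gu.
rewrite normrZ; apply: (@le_trans _ _ (e * c / M * `|slope u t r|)).
  by rewrite normrZ mulrCA ler_wpM2l.
rewrite mulrAC ler_pdivrMr// -mulrA ler_wpM2l ?(ltW e0)//.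
apply: le_trans slope_r; apply: le_trans (lift_slope_le It Ir).
by rewrite ler_wpM2l ?(ltW c_gt0) ?ler_mx_l2norm.
Qed.

Definition lift_derive t : 'cV[R]_d := ((linfun ('d G (u t)))^-1)%VF (derive1 h t).

Lemma cvg_lift_slope t : I01 t ->
  slope u t r @[r --> within (I01 `\ t) (nbhs t)] --> lift_derive t.
Proof.
move=> It; have kerG : lker (linfun ('d G (u t))) == 0%VS.
  by apply: (l2expansive_linear_inj c_gt0) => v; apply: expdG; exact: uB.
have -> : slope u t = ((linfun ('d G (u t)))^-1)%VF \o ('d G (u t) \o slope u t).
  by apply/funext => r /=; rewrite -(lfunE ('d G (u t))) lker0_lfunK.
exact: (continuous_cvg _ (@linear_continuous_cV _ _ _ _ _) (diff_lift_slope It)).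
Qed.

Lemma diff_lift_derive t : I01 t -> 'd G (u t) (lift_derive t) = derive1 h t.
Proof.
move=> It; have FP := unit_itv_limit_point It.
have dG : continuous ('d G (u t)).
  exact/diff_continuous/(C1_on_differentiable C1G (uB It)).
apply/esym; apply: cvg_unique (diff_lift_slope It) _; first exact: norm_hausdorff.
exact: (continuous_cvg _ (dG (lift_derive t)) (cvg_lift_slope It)).
Qed.

Lemma lift_derive_continuous t : I01 t ->
  lift_derive r @[r --> within I01 (nbhs t)] --> lift_derive t.
Proof.
move=> It; pose w := lift_derive t.
apply: (squeeze_l2dist (C := c^-1)
  (g := fun r => l2norm (derive1 h r - 'D_w G (u r)))).
  rewrite near_withinE; apply: nearW => r Ir.
  rewrite ler_pdivlMl// deriveE; last exact: C1_on_differentiable C1G (uB Ir).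
  by rewrite -(diff_lift_derive Ir) -(linearB ('d G (u r))); exact/expdG/uB.
have dG : differentiable G (u t) := C1_on_differentiable C1G (uB It).
have DwG : 'D_w G (u r) @[r --> within I01 (nbhs t)] --> derive1 h t.
  rewrite -(diff_lift_derive It) -(deriveE w dG).
  exact: (continuous_cvg _ (C1_on_continuous_derive C1G (uB It)) (lift_continuous It)).
have [_ h't] := C1_on_within C1h It.
rewrite -(@l2norm0 R n) -(subrr (derive1 h t)).
exact: (continuous_cvg _ (@continuous_l2norm _ _ _) (cvgB h't DwG)).
Qed.

End Lift.

Lemma C1_curve_lift (h : R -> 'cV[R]_n) : C1_on I01 h ->
  (forall t, I01 t -> (G @` B) (h t)) ->
  exists2 u, C1_on I01 u & forall t, I01 t -> B (u t) /\ G (u t) = h t.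
Proof.
move=> C1h hB; have /choice[u uP] : forall t, exists x, I01 t -> B x /\ G x = h t.
  move=> t; have [It|nIt] := pselect (I01 t); last by exists 0.
  by have [x Bx xh] := hB t It; exists x.
have uB t : I01 t -> B (u t) by move=> /uP[].
have Gu t : I01 t -> G (u t) = h t by move=> /uP[].
have [|ux C1ux uxE] := @C1_within_extend _ _ u (lift_derive h u).
  move=> t It; split; first exact: cvg_lift_slope.
  exact: lift_derive_continuous.
by exists ux => // t It; rewrite (uxE t It).1; exact: uP.
Qed.

End LiftingCurves.

(** * Taylor's estimate *)

Section TaylorEstimate.
Context {R : realType}.

Lemma is_derive_coord (n : nat) (f : R -> 'cV[R]_n) v (t : R) i :
  is_derive t (1 : R) f v -> is_derive t (1 : R) (fun r : R => f r i 0) (v i 0).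
Proof.
move=> [df <-]; split; first by have /derivable_mxP := df; apply.
by rewrite derive_mx// mxE.
Qed.

Lemma l2norm_mean_value (n : nat) (f df : R -> 'cV[R]_n) (a b K : R) : a <= b ->
  (forall t, a <= t <= b -> is_derive t (1 : R) f (df t)) ->
  (forall t, a <= t <= b -> l2norm (df t) <= K) ->
  l2norm (f b - f a) <= K * (b - a).
Proof.
move=> ab f_df dfK; set e := f b - f a.
pose phi t := \sum_i e i 0 * f t i 0; pose dphi t := \sum_i e i 0 * df t i 0.
have phi_dphi (t : R) : a <= t <= b -> is_derive t (1 : R) phi (dphi t).
  move=> tab; have -> : phi = \sum_i (e i 0 *: (fun r => f r i 0)).
    by apply/funext => r; rewrite fct_sumE.
  by apply: is_derive_sum => i; apply/is_deriveZ/is_derive_coord/f_df.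
have [||t tab phi_ab] := @MVT_segment R phi dphi a b ab.
- by move=> t; rewrite in_itv/= => /andP[ta tb]; apply: phi_dphi; rewrite !ltW.
- apply: derivable_within_continuous => t; rewrite in_itv/= => tab.
  by have [] := phi_dphi t tab.
rewrite in_itv/= in tab.
have e2 : l2norm e ^+ 2 = dphi t * (b - a).
  rewrite -phi_ab sqr_l2norm -sumrB; apply: eq_bigr => i _.
  by rewrite -mulrBr expr2 {2}/e !mxE.
have [e0|e0] := eqVneq (l2norm e) 0.
  by rewrite e0 mulr_ge0 ?subr_ge0// (le_trans _ (dfK t tab)) ?l2norm_ge0.
have e_gt0 : 0 < l2norm e by rewrite lt_def e0 l2norm_ge0.
rewrite -(ler_pM2l e_gt0) -expr2 e2 mulrA ler_wpM2r ?subr_ge0//.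
by rewrite (le_trans (l2norm_cauchy_schwarz _ _))// ler_wpM2l ?l2norm_ge0 ?dfK.
Qed.

Lemma is_derive_line (V W : normedModType R) (f : V -> W) x v (t : R) :
  differentiable f (x + t *: v) ->
  is_derive t (1 : R) (fun r : R => f (x + r *: v)) ('d f (x + t *: v) v).
Proof.
move=> df; have line_diff : is_diff t (fun r : R => x + r *: v) (fun r => 0 + r *: v).
  exact: is_diffD.
have [dfl dflE] := is_diff_comp line_diff (differentiableP df).
by split; [exact: diff_derivable|rewrite deriveE// dflE /= add0r scale1r].
Qed.

Lemma is_derive_scalel (V : normedModType R) (v : V) (t : R) :
  is_derive t (1 : R) ( *:%R^~ v) v.
Proof.
apply/is_derive1P; apply: cvg_near_cst; rewrite near_withinE.
apply: nearW => r rt; rewrite /slope -scalerBl scalerA mulVf ?scale1r//.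
by rewrite subr_eq0.
Qed.

Variables (d n : nat) (F : 'cV[R]_d -> 'cV[R]_n) (B : set 'cV[R]_d) (K : R).
Hypothesis B_convex : forall x y t, B x -> B y -> 0 <= t <= 1 -> B (x + t *: (y - x)).
Hypothesis C1F : C1_on B F.
Hypothesis K_ge0 : 0 <= K.
Hypothesis diffF_lipschitz : forall x y, B x -> B y ->
  l2opnorm (fun v => 'd F x v - 'd F y v) <= K * l2norm (x - y).

Lemma diff_lipschitz_l2norm x y v : B x -> B y ->
  l2norm ('d F x v - 'd F y v) <= K * l2norm (x - y) * l2norm v.
Proof.
move=> Bx By; apply: le_trans (ler_l2norm_opnorm ('d F x \- 'd F y) v) _.
by rewrite ler_wpM2r ?l2norm_ge0// diffF_lipschitz.
Qed.

Lemma taylor_l2norm x y : B x -> B y ->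
  l2norm (F y - F x - 'd F x (y - x)) <= K * l2norm (y - x) ^+ 2.
Proof.
move=> Bx By; set v := y - x.
pose f (t : R) := F (x + t *: v) - t *: 'd F x v.
pose df (t : R) := 'd F (x + t *: v) v - 'd F x v.
have Bt t : 0 <= t <= 1 -> B (x + t *: v) by exact: B_convex.
have f_df (t : R) : 0 <= t <= 1 -> is_derive t (1 : R) f (df t).
  move=> t01; apply: is_deriveB.
    exact/is_derive_line/(C1_on_differentiable C1F (Bt t t01)).
  exact: is_derive_scalel.
have df_le t : 0 <= t <= 1 -> l2norm (df t) <= K * l2norm v ^+ 2.
  move=> t01; apply: le_trans (diff_lipschitz_l2norm _ (Bt t t01) Bx) _.
  rewrite -mulrA ler_wpM2l// expr2 ler_wpM2r ?l2norm_ge0// addrC addKr l2normZ.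
  by case/andP: t01 => t0 t1; rewrite ger0_norm// ler_piMl ?l2norm_ge0.
have := l2norm_mean_value ler01 f_df df_le.
rewrite subr0 mulr1 /f !(scale1r, scale0r) subr0 addr0 [x + v]addrC subrK.
by rewrite addrAC.
Qed.

End TaylorEstimate.

(** * Geodesic distances under a linear map *)

Section CurveLength.
Context {R : realType}.
Local Notation I01 := (@unit_itv R).

Lemma measurable_speed n (g : R -> 'cV[R]_n) : C1_on I01 g ->
  measurable_fun I01 (fun t : R => l2norm (derive1 g t)).
Proof.
move=> Cg; apply: subspace_continuous_measurable_fun; first exact: measurable_itv.
apply: continuous_in_subspaceT => t /set_mem It.
have -> : derive1 g = 'D_1 g by apply/funext => r; rewrite derive1E.
exact: (continuous_cvg _ (@continuous_l2norm _ _ _) (C1_on_continuous_derive Cg It)).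
Qed.

Lemma curve_length_le n m (g : R -> 'cV[R]_n) (h : R -> 'cV[R]_m) k :
  0 <= k -> C1_on I01 g -> C1_on I01 h ->
  (forall t, I01 t -> l2norm (derive1 h t) <= k * l2norm (derive1 g t)) ->
  (curve_length h <= k%:E * curve_length g)%E.
Proof.
move=> k0 Cg Ch hg; rewrite /curve_length.
have mI : measurable I01 by exact: measurable_itv.
have /measurable_EFinP mg := measurable_speed Cg.
have /measurable_EFinP mh := measurable_speed Ch.
rewrite -ge0_integralZl_EFin//; last by move=> t _; rewrite lee_fin l2norm_ge0.
apply: ge0_le_integral => //.
- by move=> t _; rewrite lee_fin l2norm_ge0.
- exact: measurable_funeM.
Qed.

Lemma geodesic_dist_le n m (N : set 'cV[R]_n) a b (N' : set 'cV[R]_m) a' b' k :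
  0 < k ->
  (forall g, C1_curve_in N a b g ->
     exists2 h, C1_curve_in N' a' b' h & (curve_length h <= k%:E * curve_length g)%E) ->
  (geodesic_dist N' a' b' <= k%:E * geodesic_dist N a b)%E.
Proof.
move=> k0 transfer; rewrite -lee_pdivrMl//.
apply: le_ereal_inf_tmp => _ [g /transfer [h Nh hg] <-]; rewrite lee_pdivrMl//.
by apply: le_trans hg; apply: ereal_inf_lbound; exists h.
Qed.

Lemma derive1_mulmx m n (A : 'M[R]_(m, n)) (g : R -> 'cV[R]_n) t : C1_on I01 g ->
  I01 t -> derive1 (fun r => A *m g r) t = A *m derive1 g t.
Proof.
move=> Cg It; rewrite !derive1E.
rewrite (derive_comp_cV (V := R) (B := setT) (f := mulmx A) 1 Cg)//; last first.
  exact: C1_on_linear.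
by rewrite diff_lin//; exact: linear_continuous_cV.
Qed.

End CurveLength.

Section TangentBounds.
Context {R : realType}.
Variables (d n m : nat) (F : 'cV[R]_d -> 'cV[R]_n) (Phi : 'M[R]_(m, n)).
Local Notation B := (l2ball R d).
Local Notation I01 := (@unit_itv R).

Definition tangent_bounds (lo hi : R) : Prop :=
  forall v, unit_tangent F v -> lo <= l2norm (Phi *m v) <= hi.

Lemma tangent_boundsP lo hi x v : tangent_bounds lo hi -> B x ->
  tangent_space F x v ->
  lo * l2norm v <= l2norm (Phi *m v) <= hi * l2norm v.
Proof.
move=> bounds Bx [w _ wv]; have [->|v0] := eqVneq v 0.
  by rewrite mulmx0 !l2norm0 !mulr0 lexx.
have := bounds ((l2norm v)^-1 *: v) _.
rewrite -scalemxAr l2normZ gtr0_norm ?invr_gt0 ?l2norm_gt0// mulrC.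
rewrite ler_pdivlMr ?ler_pdivrMr ?l2norm_gt0//; apply; split.
  exact: l2norm_normalize.
by exists x => //; exists ((l2norm v)^-1 *: w) => //; rewrite linearZ -wv.
Qed.

Variables (c1 c2 lo hi : R).
Hypothesis C1F : C1_on B F.
Hypothesis c1_gt0 : 0 < c1.
Hypothesis expF : l2expansive B c1 F.
Hypothesis bounds : tangent_bounds lo hi.

Lemma derive1_tangent (g : R -> 'cV[R]_n) t : C1_on I01 g ->
  (forall r, I01 r -> (F @` B) (g r)) -> I01 t ->
  exists2 x, B x & tangent_space F x (derive1 g t).
Proof.
move=> Cg gM It.
have [u Cu uP] := C1_curve_lift c1_gt0 (@l2ball_closure_interior R d) C1F expF Cg gM.
have [But _] := uP t It; exists (u t) => //.
have CFu : C1_on I01 (F \o u) by apply: C1_on_comp C1F => // r /uP[].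
have gFu : {in I01, g =1 F \o u} by move=> r /set_mem /uP [_ <-].
rewrite (C1_within_unique (C1_on_within Cg) (C1_on_within CFu) gFu (mem_set It)).
exists (derive1 u t) => //; rewrite !derive1E.
by rewrite (derive_comp_cV (V := R) (B := B) 1 Cu)// => r /uP[].
Qed.

Lemma speed_bounds (g : R -> 'cV[R]_n) t : C1_on I01 g ->
  (forall r, I01 r -> (F @` B) (g r)) -> I01 t ->
  lo * l2norm (derive1 g t) <= l2norm (Phi *m derive1 g t) <= hi * l2norm (derive1 g t).
Proof.
by move=> Cg gM It; have [x Bx] := derive1_tangent Cg gM It; exact: tangent_boundsP.
Qed.

Hypothesis c2_gt0 : 0 < c2.
Hypothesis expPhi : l2expansive B c2 (fun x => Phi *m F x).
Hypothesis lo_gt0 : 0 < lo.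
Hypothesis hi_gt0 : 0 < hi.

Lemma geodesic_dist_mulmx_le x y :
  (geodesic_dist (mulmx Phi @` (F @` B)) (Phi *m x) (Phi *m y)
    <= hi%:E * geodesic_dist (F @` B) x y)%E.
Proof.
apply: geodesic_dist_le => // g [Cg gM g0 g1].
have CPg := C1_on_mulmx Phi Cg.
exists (fun t => Phi *m g t).
  split=> //; rewrite ?g0 ?g1// => _ [t It <-]; exists (g t) => //.
  by apply: gM; exists t.
apply: (curve_length_le (ltW hi_gt0) Cg CPg) => t It; rewrite derive1_mulmx//.
have gM' r : I01 r -> (F @` B) (g r) by move=> Ir; apply: gM; exists r.
by have /andP[] := speed_bounds Cg gM' It.
Qed.

Lemma geodesic_dist_mulmx_ge x y : (F @` B) x -> (F @` B) y ->
  (lo%:E * geodesic_dist (F @` B) x y <=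
   geodesic_dist (mulmx Phi @` (F @` B)) (Phi *m x) (Phi *m y))%E.
Proof.
move=> [x0 Bx0 <-] [y0 By0 <-] {x y}; rewrite -lee_pdivlMl//.
apply: geodesic_dist_le => [|h [Ch hM h0 h1]]; first by rewrite invr_gt0.
pose G x := Phi *m F x.
have CG : C1_on B G := C1_on_mulmx Phi C1F.
have hG t : I01 t -> (G @` B) (h t).
  by move=> It; have [|_ [x Bx <-] <-] := hM (h t); [exists t|exists x].
have [u Cu uP] := C1_curve_lift c2_gt0 (@l2ball_closure_interior R d) CG expPhi Ch hG.
have uB t : I01 t -> B (u t) by move=> /uP[].
have Cg : C1_on I01 (F \o u) by exact: C1_on_comp C1F.
have hPg : {in I01, h =1 fun t => Phi *m (F \o u) t}.
  by move=> t /set_mem /uP [_ <-].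
have CPg := C1_on_mulmx Phi Cg.
have lift_end t z : I01 t -> B z -> h t = G z -> (F \o u) t = F z.
  move=> It Bz htz; congr F; have [But Gut] := uP t It.
  by apply: (l2expansive_inj c2_gt0 expPhi But Bz); rewrite -/(G _) Gut.
have I0 : I01 0 by apply/unit_itvP; rewrite lexx ler01.
have I1 : I01 1 by apply/unit_itvP; rewrite lexx ler01.
exists (F \o u).
  split=> //; [|exact: lift_end|exact: lift_end].
  by move=> _ [t It <-]; exists (u t) => //; exact: uB.
apply: curve_length_le => [|//|//|t It]; first by rewrite invr_ge0 ltW.
rewrite ler_pdivlMl//.
rewrite (C1_within_unique (C1_on_within Ch) (C1_on_within CPg) hPg (mem_set It)).
rewrite derive1_mulmx//.
have gM r : I01 r -> (F @` B) ((F \o u) r) by move=> Ir; exists (u r) => //; exact: uB.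
by have /andP[] := speed_bounds Cg gM It.
Qed.

End TangentBounds.

Section GeodesicPreservation.
Context {R : realType}.
Variables (d n m : nat) (F : 'cV[R]_d -> 'cV[R]_n) (Phi : 'M[R]_(m, n)).
Variables (c K lo hi : R).
Local Notation B := (l2ball R d).
Hypothesis C1F : C1_on B F.
Hypothesis c_gt0 : 0 < c.
Hypothesis expF : l2expansive B c F.
Hypothesis K_ge0 : 0 <= K.
Hypothesis diffF_lipschitz : forall x y, B x -> B y ->
  l2opnorm (fun v => 'd F x v - 'd F y v) <= K * l2norm (x - y).
Hypothesis lo_gt0 : 0 < lo.
Hypothesis hi_gt0 : 0 < hi.

Definition preserves_geodesics : Prop :=
  tangent_bounds F Phi lo hi ->
  forall x y, (F @` B) x -> (F @` B) y ->
    (lo%:E * geodesic_dist (F @` B) x y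
       <= geodesic_dist (mulmx Phi @` (F @` B)) (Phi *m x) (Phi *m y)
       <= hi%:E * geodesic_dist (F @` B) x y)%E.

Lemma l2expansive_preserves_geodesics c' : 0 < c' ->
  l2expansive B c' (fun x => Phi *m F x) -> preserves_geodesics.
Proof.
move=> c'_gt0 expPhi bounds x y Mx My; apply/andP; split.
  exact: (geodesic_dist_mulmx_ge C1F c_gt0 expF bounds c'_gt0 expPhi).
exact: (geodesic_dist_mulmx_le C1F c_gt0 expF bounds).
Qed.

Variables (N r kappa : R).
Hypothesis N_ge0 : 0 <= N.
Hypothesis Phi_le : forall v, l2norm (Phi *m v) <= N * l2norm v.
Hypothesis short_r : N * K * r <= lo * c / 2.

Lemma short_chord_expansive x y : tangent_bounds F Phi lo hi -> B x -> B y ->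
  l2norm (x - y) <= r ->
  lo * c / 2 * l2norm (x - y) <= l2norm (Phi *m F x - Phi *m F y).
Proof.
move=> bounds Bx By xy; set v := x - y in xy *; set D := 'd F y v.
have main : lo * (c * l2norm v) <= l2norm (Phi *m D).
  have Dv : tangent_space F y D by exists v.
  have /andP[+ _] := tangent_boundsP bounds By Dv; apply: le_trans.
  rewrite ler_pM2l//.
  exact: (l2expansive_diff _ (@l2ball_closure_interior R d) expF C1F By).
have error : l2norm (Phi *m D - (Phi *m F x - Phi *m F y)) <= lo * c / 2 * l2norm v.
  rewrite -!mulmxBr -opprB mulmxN l2normN.
  have taylor := taylor_l2norm (@l2ball_convex R d) C1F K_ge0 diffF_lipschitz By Bx.
  apply: le_trans (Phi_le _) _; apply: le_trans (ler_wpM2l N_ge0 taylor) _.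
  rewrite expr2 !mulrA ler_wpM2r ?l2norm_ge0//; apply: le_trans short_r.
  by rewrite ler_wpM2l// mulr_ge0.
have := lerB_l2dist (Phi *m D) (Phi *m D - (Phi *m F x - Phi *m F y)).
by rewrite subKr; lra.
Qed.

Lemma long_chords_preserve_geodesics : 0 < kappa ->
  (forall x y, B x -> B y -> r <= l2norm (x - y) ->
     kappa <= l2norm (Phi *m F x - Phi *m F y)) ->
  preserves_geodesics.
Proof.
move=> kappa_gt0 long bounds.
apply: (l2expansive_preserves_geodesics (c' := Num.min (kappa / 2) (lo * c / 2))) => //.
  by rewrite lt_min !divr_gt0// mulr_gt0.
move=> x y Bx By; have [xy|/ltW xy] := leP r (l2norm (x - y)).
  apply: le_trans (long x y Bx By xy).
  have xy2 : l2norm (x - y) <= 2.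
    rewrite (le_trans (ler_l2normB _ _))//; move: Bx By; rewrite /l2ball/=; lra.
  apply: (@le_trans _ _ (kappa / 2 * 2)); last by rewrite divfK.
  apply: ler_pM; rewrite ?l2norm_ge0 ?ge_min ?lexx//.
  by rewrite le_min !ltW ?divr_gt0 ?mulr_gt0.
apply: le_trans (short_chord_expansive bounds Bx By xy).
by rewrite ler_wpM2r ?l2norm_ge0// ge_min lexx orbT.
Qed.

End GeodesicPreservation.

(** * Small ball estimate for sparse sign matrices *)

Section Counting.

Lemma exists_subset_card (T : finType) (A : {set T}) k : (k <= #|A|)%N ->
  exists2 B : {set T}, B \subset A & #|B| = k.
Proof.
move=> /card_geqP[s [uniq_s size_s sA]]; exists [set x in s]%SET.
  by apply/fintype.subsetP => x; rewrite inE => /sA.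
by rewrite cardsE -size_s; exact/card_uniqP.
Qed.

Lemma exists_superset_card (T : finType) (A : {set T}) k : (#|A| <= k <= #|T|)%N ->
  exists2 B : {set T}, A \subset B & #|B| = k.
Proof.
move=> /andP[Ak kT]; have [|C CA Ck] := @exists_subset_card T (~: A)%SET (#|T| - k).
  by rewrite cardsCs finset.setCK leq_sub2l.
exists (~: C)%SET; first by rewrite -[A]finset.setCK finset.setCS.
by rewrite cardsCs finset.setCK Ck subKn.
Qed.

Lemma bin_leq_expn2 n k : ('C(n, k) <= 2 ^ n)%N.
Proof.
rewrite -[n]card_ord -card_draws -cardsT -card_powerset; apply: subset_leq_card.
by apply/fintype.subsetP => A _; rewrite powersetE finset.subsetT.
Qed.

Lemma leq_expn_bin_fact k : (k ^ k <= 4 ^ k * k`!)%N.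
Proof.
apply: (@leq_trans ((2 * k) ^_ k)); last first.
  by rewrite -bin_ffact leq_mul2r -[4%N]/(2 ^ 2)%N -expnM bin_leq_expn2 orbT.
rewrite ffact_prod -[X in (_ ^ X)%N]card_ord -prod_nat_const.
by apply: leq_prod => i _; have := ltn_ord i; lia.
Qed.

Lemma bin_leq_expn n k : ('C(n, k) * k ^ k <= (4 * n) ^ k)%N.
Proof.
apply: (@leq_trans ('C(n, k) * (4 ^ k * k`!))).
  by rewrite leq_mul2l leq_expn_bin_fact orbT.
rewrite mulnCA bin_ffact expnMn leq_mul2l ffact_prod -[X in (n ^ X)%N]card_ord.
rewrite -prod_nat_const; apply/orP; right; apply: leq_prod => i _; exact: leq_subr.
Qed.

Lemma ler_bin_expr (R : realType) n k : (0 < k)%N ->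
  'C(n, k)%:R <= (4 * n%:R / k%:R) ^+ k :> R.
Proof.
move=> k0; rewrite expr_div_n ler_pdivlMr ?exprn_gt0 ?ltr0n//.
by rewrite -!natrX -natrM -natrX -natrM ler_nat bin_leq_expn.
Qed.

End Counting.

Section SmallBall.
Context {R : realType}.
Variables m n : nat.
Local Notation mask := {ffun 'I_m * 'I_n -> bool}.
Local Notation pattern := (mask * mask)%type.
Implicit Types (a b : mask) (x : pattern) (v : 'cV[R]_n).
Implicit Types (K : {set 'I_n}) (A S : {set 'I_m}) (rho tau : R).

(* The first mask holds the signs, [true] standing for -1, and the second one
   the positions of the nonzero entries. *)
Definition pattern_matrix x : 'M[R]_(m, n) :=
  \matrix_(i, j) ((-1) ^+ x.1 (i, j) * (x.2 (i, j))%:R).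

Lemma pattern_matrix_mulE x v i :
  (pattern_matrix x *m v) i 0 = \sum_j (-1) ^+ x.1 (i, j) * (x.2 (i, j))%:R * v j 0.
Proof. by rewrite mxE; apply: eq_bigr => j _; rewrite mxE. Qed.

Lemma ler_pattern_matrix_coord x v i e : (forall j, `|v j 0| <= e) ->
  `|(pattern_matrix x *m v) i 0| <= n%:R * e.
Proof.
move=> ve; rewrite pattern_matrix_mulE (le_trans (ler_norm_sum _ _ _))//.
rewrite mulr_natl -[n in _ *+ n]card_ord -sumr_const; apply: ler_sum => j _.
rewrite !normrM normrX normrN1 expr1n mul1r (le_trans _ (ve j))//.
by rewrite ler_piMl//; case: (x.2 _); rewrite ?normr1 ?normr0.
Qed.

Definition small_rows v (rho : R) : pred pattern :=
  fun x => [forall i, `|(pattern_matrix x *m v) i 0| <= rho].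

Definition large_coords v (tau : R) : {set 'I_n} := [set j | tau <= `|v j 0|]%SET.

Definition touched b K : {set 'I_m} := [set i | [exists j in K, b (i, j)]]%SET.

Lemma small_row_flip a a' b v rho i j : rho < `|v j 0| -> b (i, j) ->
  a (i, j) = ~~ a' (i, j) -> (forall k, k != j -> a (i, k) = a' (i, k)) ->
  `|(pattern_matrix (a, b) *m v) i 0| <= rho ->
  ~ `|(pattern_matrix (a', b) *m v) i 0| <= rho.
Proof.
move=> vj bij aij aik a_small a'_small.
have row_diff : (pattern_matrix (a, b) *m v) i 0 - (pattern_matrix (a', b) *m v) i 0 =
    2 * ((-1) ^+ a (i, j) * v j 0).
  rewrite !pattern_matrix_mulE -sumrB (bigD1 j)//= big1 ?addr0 => [|k kj].
    by rewrite aij bij; case: (a' (i, j)); rewrite /= ?expr0 ?expr1; ring.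
  by rewrite aik// subrr.
have := le_trans (ler_normB _ _) (lerD a_small a'_small).
rewrite row_diff normrM (@ger0_norm _ 2)// normrM normrX normrN1 expr1n mul1r.
by lra.
Qed.

Definition pivot b K i : option 'I_n := [pick j in K | b (i, j)].

Definition flip_pivots b K a A : mask :=
  [ffun p => a p (+) ((p.1 \in A) && (Some p.2 == pivot b K p.1))].

Lemma touched_pivot b K i : i \in touched b K ->
  exists2 j, pivot b K i = Some j & (j \in K) && b (i, j).
Proof.
rewrite inE /pivot => /existsP[j0 bj0]; case: pickP => [j bj|/(_ j0)].
  by exists j.
by rewrite bj0.
Qed.

Lemma flip_pivots_inj b v K rho a A a' A' : (forall j, j \in K -> rho < `|v j 0|) ->
  small_rows v rho (a, b) -> small_rows v rho (a', b) ->
  A \subset touched b K -> A' \subset touched b K ->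
  flip_pivots b K a A = flip_pivots b K a' A' -> (a, A) = (a', A').
Proof.
move=> Kv /forallP a_small /forallP a'_small sA sA' /ffunP flipE.
have flipE_at i j : a (i, j) (+) ((i \in A) && (Some j == pivot b K i)) =
    a' (i, j) (+) ((i \in A') && (Some j == pivot b K i)).
  by have := flipE (i, j); rewrite !ffunE.
suff AA' : A = A'.
  by subst A'; congr pair; apply/ffunP => -[i j]; have /addIb := flipE_at i j.
apply/setP => i; apply/eqP/negPn/negP => neA.
have /touched_pivot[j pivj /andP[jK bij]] : i \in touched b K.
  move: neA; have [iA _|_] := boolP (i \in A); first exact: (fintype.subsetP sA).
  by have [iA' _|//] := boolP (i \in A'); exact: (fintype.subsetP sA').
apply: (small_row_flip (Kv j jK) bij _ _ (a_small i) (a'_small i)).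
  have := flipE_at i j; rewrite pivj eqxx !andbT; move: neA.
  by case: (i \in A); case: (i \in A'); case: (a (i, j)); case: (a' (i, j)).
move=> k kj; have := flipE_at i k; rewrite pivj (_ : (Some k == Some j) = false).
  by rewrite !andbF !addbF.
exact/negbTE.
Qed.

(* Flipping one sign in each of the touched rows of a chosen set moves a small
   sign pattern out of the small ones, and the moves are jointly injective. *)
Lemma card_small_signs b v K rho : (forall j, j \in K -> rho < `|v j 0|) ->
  (#|[set a : mask | small_rows v rho (a, b)]%SET| * 2 ^ #|touched b K|
    <= 2 ^ (m * n))%N.
Proof.
move=> Kv; rewrite -card_powerset -cardsX.
have -> : (2 ^ (m * n) = #|{: mask}|)%N.
  by rewrite card_ffun card_bool card_prod !card_ord.
rewrite -(@card_in_imset _ _ (fun y => flip_pivots b K y.1 y.2)) ?max_card//.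
move=> [a A] [a' A']; rewrite !inE/= => /andP[a_small sA] /andP[a'_small sA'].
exact: flip_pivots_inj Kv a_small a'_small sA sA'.
Qed.

Record sparse_mask_law (s : nat) (q : mask -> R) : Prop := SparseMaskLaw {
  mask_law_ge0 : forall b, 0 <= q b ;
  mask_law_sum1 : \sum_b q b = 1 ;
  mask_law_columns : forall K S,
    \sum_(b : mask | [forall j in K, forall i, b (i, j) ==> (i \in S)]) q b
      <= ('C(#|S|, s)%:R * (s%:R / m%:R) ^+ s) ^+ #|K| }.

Variables (s : nat) (q : mask -> R).
Hypothesis s_gt0 : (0 < s)%N.
Hypothesis lawq : sparse_mask_law s q.

Let q_ge0 := mask_law_ge0 lawq.

(* The law of independent uniform signs together with a mask of law [q]. *)
Definition pattern_prb (Q : pred pattern) : R :=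
  \sum_b q b * (#|[set a | Q (a, b)]%SET|%:R / 2 ^+ (m * n)).

Lemma pattern_prb_union (I : finType) (D : pred I) (Q : I -> pred pattern) :
  pattern_prb (fun x => [exists i, D i && Q i x]) <= \sum_(i | D i) pattern_prb (Q i).
Proof.
rewrite /pattern_prb exchange_big/=; apply: ler_sum => b _.
rewrite -mulr_sumr ler_wpM2l// -mulr_suml ler_wpM2r ?invr_ge0 ?exprn_ge0//.
rewrite -natr_sum ler_nat.
have -> : [set a | [exists i, D i && Q i (a, b)]]%SET =
    (\bigcup_(i | D i) [set a | Q i (a, b)])%SET.
  apply/setP => a; rewrite inE; apply/existsP/bigcupP => -[i].
    by move=> /andP[Di Qi]; exists i; rewrite ?inE.
  by move=> Di; rewrite inE => Qi; exists i; rewrite Di.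
apply: (big_ind2 (fun (U : {set mask}) k => #|U| <= k)%N) => [|U k V l Uk Vl|//].
  by rewrite cards0.
exact: leq_trans (leq_card_setU _ _) (leq_add Uk Vl).
Qed.

Lemma mask_prb_touched_le K l : (l <= m)%N ->
  \sum_(b : mask | (#|touched b K| <= l)%N) q b
    <= 'C(m, l)%:R * ('C(l, s)%:R * (s%:R / m%:R) ^+ s) ^+ #|K|.
Proof.
move=> lm; pose supported (S : {set 'I_m}) b :=
  [forall j in K, forall i, b (i, j) ==> (i \in S)].
have touchedS b (S : {set 'I_m}) : touched b K \subset S -> supported S b.
  move=> /fintype.subsetP tS; apply/forallP => j; apply/implyP => jK.
  apply/forallP => i; apply/implyP => bij; apply: tS.
  by rewrite inE; apply/existsP; exists j; rewrite jK.
apply: (@le_trans _ _ (\sum_(S : {set 'I_m} | #|S| == l) \sum_(b | supported S b) q b)).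
  rewrite (exchange_big_dep xpredT)//= [leRHS]big_mkcond/= big_mkcond/=.
  apply: ler_sum => b _; case: ifPn => [tl|_]; last by apply: sumr_ge0.
  have [|S tS Sl] := @exists_superset_card _ (touched b K) l.
    by rewrite tl card_ord.
  by rewrite (bigD1 S)/= ?lerDl ?sumr_ge0// Sl eqxx touchedS.
apply: (@le_trans _ _ (\sum_(S : {set 'I_m} | #|S| == l)
    ('C(l, s)%:R * (s%:R / m%:R) ^+ s) ^+ #|K|)).
  by apply: ler_sum => S /eqP Sl; rewrite -{1}Sl; exact: mask_law_columns.
have <- : #|[pred S : {set 'I_m} | #|S| == l]| = 'C(m, l).
  by rewrite -[m in RHS]card_ord -card_draws cardsE.
by rewrite sumr_const [leRHS]mulr_natl.
Qed.

Lemma bin_product_le l k : (64 * l <= s * k)%N -> (s * k <= m)%N -> (0 < l)%N ->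
  'C(m, l)%:R * ('C(l, s)%:R * (s%:R / m%:R) ^+ s) ^+ k <= 2 ^- l :> R.
Proof.
move=> lk km l0; have m0 : (0 < m)%N by lia.
pose y : R := 4 * l%:R / m%:R.
have [mR_gt0 lR_gt0 sR_gt0] : [/\ 0 < m%:R :> R, 0 < l%:R :> R & 0 < s%:R :> R].
  by rewrite !ltr0n.
have y0 : 0 < y by rewrite divr_gt0// mulr_gt0.
have y1 : y <= 16^-1.
  rewrite /y ler_pdivrMr// ler_pdivlMl//.
  by rewrite -natrM -natrM ler_nat; lia.
have p0 : 0 <= 'C(l, s)%:R * (s%:R / m%:R) ^+ s :> R.
  by rewrite mulr_ge0// exprn_ge0// divr_ge0.
have py : 'C(l, s)%:R * (s%:R / m%:R) ^+ s <= y ^+ s :> R.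
  apply: (le_trans (ler_wpM2r _ (ler_bin_expr R l s_gt0))).
    by rewrite exprn_ge0// divr_ge0.
  by rewrite -exprMn mulrA divfK// gt_eqF.
have Cy : 'C(m, l)%:R <= (16 / y) ^+ l :> R.
  apply: (le_trans (ler_bin_expr R m l0)).
  rewrite le_eqVlt; apply/orP; left; apply/eqP; congr (_ ^+ _); rewrite /y; field.
  by rewrite !gt_eqF.
have pky : ('C(l, s)%:R * (s%:R / m%:R) ^+ s) ^+ k <= y ^+ (64 * l).
  apply: (@le_trans _ _ (y ^+ (s * k))).
    by rewrite exprM lerXn2r ?nnegrE ?exprn_ge0 ?(ltW y0).
  by rewrite ler_wiXn2l ?(ltW y0)//; lra.
apply: (@le_trans _ _ ((16 / y) ^+ l * y ^+ (64 * l))).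
  by apply: ler_pM => //; exact: exprn_ge0.
rewrite exprM -exprMn -exprVn ler_pXn2r ?nnegrE ?mulr_ge0 ?exprn_ge0 ?divr_ge0
  ?invr_ge0 ?(ltW y0)//.
rewrite (exprSr _ 63) [_ * y]mulrC mulrA divfK ?gt_eqF//.
have : y ^+ 63 <= y ^+ 2 by rewrite ler_wiXn2l ?(ltW y0)//; lra.
rewrite expr2; nra.
Qed.

(* The columns of [K] meet at most [l] rows with probability [2 ^- l] only, and
   a configuration meeting more is small for a fraction [2 ^- l] of the signs. *)
Lemma pattern_prb_small_rows_columns v K rho l :
  (forall j, j \in K -> rho < `|v j 0|) ->
  (64 * l <= s * #|K|)%N -> (s * #|K| <= m)%N ->
  pattern_prb (small_rows v rho) <= 2 * 2 ^- l.
Proof.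
move=> Kv lK Km.
have small_frac b : #|[set a | small_rows v rho (a, b)]%SET|%:R / 2 ^+ (m * n) <=
    2 ^- #|touched b K| :> R.
  rewrite ler_pdivrMr ?exprn_gt0// mulrC ler_pdivlMr ?exprn_gt0//.
  by rewrite -!natrX -natrM ler_nat card_small_signs.
have small_frac_le1 b :
    #|[set a | small_rows v rho (a, b)]%SET|%:R / 2 ^+ (m * n) <= 1 :> R.
  apply: le_trans (small_frac b) _.
  by rewrite invf_le1 ?exprn_gt0// exprn_ege1// ler1n.
have [->|l0] := posnP l.
  rewrite expr0 invr1 mulr1 (le_trans (y := 1))// ?ler1n// -(mask_law_sum1 lawq).
  by apply: ler_sum => b _; rewrite ler_piMr.
rewrite /pattern_prb (bigID (fun b => #|touched b K| <= l)%N)/= mulr2n mulrDl mul1r.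
apply: lerD.
  have lm : (l <= m)%N by lia.
  apply: le_trans (bin_product_le lK Km l0); apply: le_trans (mask_prb_touched_le K lm).
  by apply: ler_sum => b _; rewrite ler_piMr.
apply: (@le_trans _ _ (\sum_(b | ~~ (#|touched b K| <= l)%N) q b * 2 ^- l)).
  apply: ler_sum => b; rewrite -ltnNge => lb; rewrite ler_wpM2l//.
  apply: le_trans (small_frac b) _.
  by rewrite lef_pV2 ?posrE ?exprn_gt0// ler_weXn2l ?ler1n// ltnW.
rewrite -mulr_suml ler_piMl ?invr_ge0 ?exprn_ge0// -(mask_law_sum1 lawq).
by rewrite [leRHS](bigID (fun b => #|touched b K| <= l)%N)/= lerDr sumr_ge0.
Qed.

Definition small_ball_exponent k : nat := (s * minn k (m %/ s)) %/ 64.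

Lemma pattern_prb_small_rows v rho tau k : rho < tau ->
  (k <= #|large_coords v tau|)%N ->
  pattern_prb (small_rows v rho) <= 2 * 2 ^- small_ball_exponent k.
Proof.
move=> rho_tau kv.
have [|K Kv Kk] := @exists_subset_card _ (large_coords v tau) (minn k (m %/ s)).
  by rewrite geq_min kv.
apply: (pattern_prb_small_rows_columns (K := K)); rewrite ?Kk.
- move=> j /(fintype.subsetP Kv); rewrite inE; exact: lt_le_trans.
- by rewrite mulnC leq_divM.
- apply: (@leq_trans (s * (m %/ s))); last by rewrite mulnC leq_divM.
  by rewrite leq_mul2l geq_minr orbT.
Qed.

Definition bad_family (I : finType) (V : I -> 'cV[R]_n) (rho tau : R) k :
    pred pattern :=
  fun x => [exists c, (k <= #|large_coords (V c) tau|)%N && small_rows (V c) rho x].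

Lemma pattern_prb_bad_family (I : finType) (V : I -> 'cV[R]_n) (rho tau : R) k :
  rho < tau ->
  pattern_prb (bad_family V rho tau k) <= #|I|%:R * (2 * 2 ^- small_ball_exponent k).
Proof.
move=> rho_tau; apply: (le_trans (pattern_prb_union _ _)) => /=.
apply: (@le_trans _ _ (\sum_(c | (k <= #|large_coords (V c) tau|)%N)
    (2 * 2 ^- small_ball_exponent k))).
  by apply: ler_sum => c; exact: pattern_prb_small_rows.
rewrite sumr_const -[leLHS]mulr_natl ler_wpM2r// ler_nat; exact: max_card.
Qed.

End SmallBall.

(** * The law of the SJLT *)

Section FiniteLaw.
Context {R : realType} {disp : measure_display} {T : measurableType disp}.
Variable P : probability T R.

Lemma fineK_probability (A : set T) : measurable A -> (fine (P A))%:E = P A.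
Proof. by move=> mA; rewrite fineK// fin_num_measure. Qed.

Lemma probability_fintype (I : finType) (X : T -> I) (Q : pred I) :
  (forall x, measurable [set w | X w = x]) ->
  measurable [set w | Q (X w)] /\
  P [set w | Q (X w)] = (\sum_(x | Q x) fine (P [set w | X w = x]))%:E.
Proof.
move=> mX.
have mem_law (r : seq I) : uniq r -> measurable [set w | X w \in r] /\
    P [set w | X w \in r] = (\sum_(x <- r) fine (P [set w | X w = x]))%:E.
  elim: r => [_|x r IH /= /andP[xr /IH[mr Pr]]].
    rewrite big_nil (_ : [set w | _] = set0) ?measure0//.
    by apply/seteqP; split => w.
  have -> : [set w | X w \in x :: r] = [set w | X w = x] `|` [set w | X w \in r].
    apply/seteqP; split=> w /=; rewrite inE.
      by case/orP => [/eqP|] ?; [left|right].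
    by case=> [->|->]; rewrite ?eqxx ?orbT.
  split; first exact: measurableU.
  rewrite measureU//; last first.
    by apply/seteqP; split => // w [/= ->]; rewrite (negbTE xr).
  by rewrite big_cons EFinD -Pr fineK_probability.
have -> : [set w | Q (X w)] = [set w | X w \in enum Q].
  by apply/seteqP; split => w /=; rewrite mem_enum.
by have [mQ ->] := mem_law (enum Q) (enum_uniq Q); rewrite big_enum.
Qed.

End FiniteLaw.

Section GeneratedSigmaAlgebra.
Context {R : realType} {disp : measure_display} {T : measurableType disp}.
Variables (P : probability T R) (J : Type) (X : J -> {RV P >-> R}).

Lemma sigma_algebra_of_preimage j (B : set R) :
  measurable B -> sigma_algebra_of X (X j @^-1` B).
Proof.
move=> mB; apply: sub_sigma_algebra; exists j => //.
by exists B => //; rewrite setTI.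
Qed.

Lemma sigma_algebra_of_forall (K : finType) (A : K -> set T) :
  (forall k, sigma_algebra_of X (A k)) ->
  sigma_algebra_of X [set w | forall k, A k w].
Proof.
move=> XA; pose G := \bigcup_i preimage_set_system [set: T] (X i) measurable.
have -> : [set w | forall k, A k w] = \bigcap_(k in [set: K]) A k.
  by apply/seteqP; split => [w wA k _|w wA k]; exact: wA.
suff : measurable (\bigcap_(k in [set: K]) A k : set (g_sigma_algebraType G)) by [].
by apply: fin_bigcap_measurable => [|k _]; [exact: finite_finset|exact: XA].
Qed.

Lemma sigma_algebra_ofT : sigma_algebra_of X setT.
Proof.
have -> : [set: T] = [set w | forall k : void, (fun _ : void => set0) k w].
  by apply/seteqP; split => // w _ [].
exact: sigma_algebra_of_forall.
Qed.

Lemma sigma_algebra_of_measurable A : sigma_algebra_of X A -> measurable A.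
Proof.
apply: smallest_sub; first exact: sigma_algebra_measurable.
move=> _ [j _ [B mB <-]]; rewrite setTI -[_ @^-1` _]setTI.
exact: (measurable_funP (X j)).
Qed.

End GeneratedSigmaAlgebra.

Section SjltLaw.
Context {R : realType} {disp : measure_display} {T : measurableType disp}.
Variables (P : probability T R) (m n s : nat).
Variables sigma delta : 'I_m -> 'I_n -> {RV P >-> R}.
Hypothesis factors : sjlt_factors s sigma delta.
Local Notation mask := {ffun 'I_m * 'I_n -> bool}.

Definition sign_mask (w : T) : mask := [ffun p => sigma p.1 p.2 w == -1].
Definition delta_mask (w : T) : mask := [ffun p => delta p.1 p.2 w == 1].
Definition sjlt_pattern (w : T) : mask * mask := (sign_mask w, delta_mask w).
Definition delta_law (b : mask) : R := fine (P [set w | delta_mask w = b]).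

Lemma delta_mask_nat w i j : delta i j w = (delta_mask w (i, j))%:R.
Proof.
rewrite ffunE /=; have [->|->] := delta_01 factors i j w; rewrite ?eqxx//.
by rewrite lt_eqF.
Qed.

Lemma sign_mask_expr w i j : sigma i j w = (-1) ^+ sign_mask w (i, j).
Proof.
rewrite ffunE /=; have [sign _ _] := sigma_rademacher factors i j.
by case: (sign w) => ->; rewrite ?eqxx ?expr1// gt_eqF ?expr0//; lra.
Qed.

Lemma sign_mask_eqE a : [set w | sign_mask w = a] =
  [set w | forall p, (sigma p.1 p.2 @^-1` [set (-1) ^+ a p]) w].
Proof.
apply/seteqP; split=> w /=; first by move=> <- [i j]; exact: sign_mask_expr.
move=> wa; apply/ffunP => p; rewrite ffunE wa.
by case: (a p); rewrite ?expr1 ?eqxx// expr0 gt_eqF//; lra.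
Qed.

Lemma delta_mask_eqE b : [set w | delta_mask w = b] =
  [set w | forall p, (delta p.1 p.2 @^-1` [set (b p)%:R]) w].
Proof.
apply/seteqP; split=> w /=; first by move=> <- [i j]; exact: delta_mask_nat.
move=> wb; apply/ffunP => p; rewrite ffunE wb.
by case: (b p); rewrite ?eqxx// lt_eqF.
Qed.

Lemma sign_mask_event a :
  sigma_algebra_of (fun p : 'I_m * 'I_n => sigma p.1 p.2) [set w | sign_mask w = a].
Proof.
rewrite sign_mask_eqE; apply: sigma_algebra_of_forall => p.
exact: (sigma_algebra_of_preimage (X := fun p : 'I_m * 'I_n => sigma p.1 p.2)).
Qed.

Lemma delta_mask_event b :
  sigma_algebra_of (fun p : 'I_m * 'I_n => delta p.1 p.2) [set w | delta_mask w = b].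
Proof.
rewrite delta_mask_eqE; apply: sigma_algebra_of_forall => p.
exact: (sigma_algebra_of_preimage (X := fun p : 'I_m * 'I_n => delta p.1 p.2)).
Qed.

Lemma measurable_delta_mask b : measurable [set w | delta_mask w = b].
Proof. exact: sigma_algebra_of_measurable (delta_mask_event b). Qed.

Lemma sign_mask_uniform a : P [set w | sign_mask w = a] = (2 ^- (m * n))%:E.
Proof.
have -> : [set w | sign_mask w = a] = \bigcap_(p in [set` [set: 'I_m * 'I_n]%SET])
    (sigma p.1 p.2 @^-1` [set (-1) ^+ a p]).
  rewrite sign_mask_eqE; apply/seteqP; split => [w wa p _|w wa p]; first exact: wa.
  by apply: wa; rewrite /= inE.
rewrite (sigma_indep factors) => [|p _]; last first.
  exact: (@sigma_algebra_of_preimage _ _ _ P _ (fun _ : unit => sigma p.1 p.2) tt).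
rewrite (eq_bigr (fun=> (2^-1)%:E)) => [|p _]; last first.
  have [_ plus minus] := sigma_rademacher factors p.1 p.2.
  by case: (a p); rewrite ?expr1 ?expr0.
by rewrite -(big_morph EFin EFinM erefl) prodr_const cardsT card_prod !card_ord exprVn.
Qed.

Lemma sjlt_pattern_eqE a b : [set w | sjlt_pattern w = (a, b)] =
  [set w | sign_mask w = a] `&` [set w | delta_mask w = b].
Proof. by apply/seteqP; split=> w /= => [[-> ->]//|[<- <-]]. Qed.

Lemma sjlt_pattern_law a b :
  P [set w | sjlt_pattern w = (a, b)] = (2 ^- (m * n) * delta_law b)%:E.
Proof.
rewrite sjlt_pattern_eqE.
rewrite (sigma_delta_indep factors (sign_mask_event a) (delta_mask_event b)).
by rewrite sign_mask_uniform EFinM fineK_probability//; exact: measurable_delta_mask.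
Qed.

Lemma probability_sjlt_pattern (Q : pred (mask * mask)) :
  measurable [set w | Q (sjlt_pattern w)] /\
  P [set w | Q (sjlt_pattern w)] = (pattern_prb delta_law Q)%:E.
Proof.
have mX x : measurable [set w | sjlt_pattern w = x].
  case: x => a b; rewrite sjlt_pattern_eqE.
  apply: measurableI; last exact: measurable_delta_mask.
  exact: sigma_algebra_of_measurable (sign_mask_event a).
have [mQ ->] := probability_fintype P Q mX; split => //; congr EFin.
rewrite (eq_bigr (fun x => 2 ^- (m * n) * delta_law x.2)) => [|[a b] _]; last first.
  by rewrite sjlt_pattern_law.
pose f (a b : mask) := if Q (a, b) then 2 ^- (m * n) * delta_law b else 0.
rewrite big_mkcond (eq_bigr (fun x => f x.1 x.2)) => [|[a b] _//].
rewrite -(pair_bigA _ f)/= exchange_big/=.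
apply: eq_bigr => b _; rewrite -big_mkcond/= sumr_const -[LHS]mulr_natl.
by rewrite cardsE mulrA mulrC.
Qed.

Lemma delta_law_ge0 b : 0 <= delta_law b.
Proof. by rewrite fine_ge0. Qed.

Lemma delta_law_sum1 : \sum_b delta_law b = 1.
Proof.
have [_] := probability_fintype P xpredT measurable_delta_mask.
rewrite (_ : [set w | _] = setT) ?probability_setT; first by case.
by apply/seteqP; split.
Qed.

Lemma delta_law_unreached b : (forall w, delta_mask w != b) -> delta_law b = 0.
Proof.
move=> nb; rewrite /delta_law (_ : [set w | _] = set0) ?measure0//.
by apply/seteqP; split => // w /eqP; rewrite (negbTE (nb w)).
Qed.

Lemma delta_law_ones j (S : {set 'I_m}) : #|S| = s ->
  \sum_(b : mask | [forall i in S, b (i, j)]) delta_law b <= (s%:R / m%:R) ^+ s.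
Proof.
move=> Ss; pose ones_on (b : mask) := [forall i in S, b (i, j)].
pose E := [set w | ones_on (delta_mask w)].
have [mE PE] := probability_fintype P ones_on measurable_delta_mask.
rewrite -/E in mE PE; have := delta_moment factors j S.
have -> : (fun w => \prod_(i in S) delta i j w) = \1_E.
  apply/funext => w; rewrite indicE.
  have -> : (w \in E) = ones_on (delta_mask w) by apply/idP/idP; rewrite inE.
  have [/forallP wS|] := boolP (ones_on _).
    by rewrite big1// => i iS; rewrite delta_mask_nat; have /implyP/(_ iS) -> := wS i.
  rewrite negb_forall => /existsP[i]; rewrite negb_imply => /andP[iS iw].
  by rewrite (bigD1 i)//= delta_mask_nat (negbTE iw) mul0r.
by rewrite expectation_indic// PE lee_fin Ss.
Qed.

Lemma delta_law_column j (S : {set 'I_m}) :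
  \sum_(b : mask | [forall i, b (i, j) ==> (i \in S)]) delta_law b
    <= 'C(#|S|, s)%:R * (s%:R / m%:R) ^+ s.
Proof.
apply: (@le_trans _ _ (\sum_(S' : {set 'I_m} | (S' \subset S) && (#|S'| == s))
    \sum_(b : mask | [forall i in S', b (i, j)]) delta_law b)); last first.
  apply: le_trans (ler_sum _ (fun S' h => delta_law_ones j (eqP (andP h).2))) _.
  rewrite sumr_const -[leLHS]mulr_natl ler_wpM2r ?exprn_ge0 ?divr_ge0//.
  by rewrite ler_nat -cards_draws cardsE.
rewrite (exchange_big_dep xpredT)//= big_mkcond/=.
have sum_ge0 b (Q : pred {set 'I_m}) : 0 <= \sum_(S' | Q S') delta_law b.
  by apply: sumr_ge0 => S' _; exact: delta_law_ge0.
apply: ler_sum => b _; case: ifPn => // /forallP bS.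
have [[w bw]|/forallNP nw] := pselect (exists w, delta_mask w = b); last first.
  by rewrite [leLHS]delta_law_unreached ?sum_ge0// => w; exact/eqP.
rewrite (bigD1 [set i | b (i, j)]%SET)/= ?lerDl ?sum_ge0//.
apply/andP; split; [apply/andP; split|].
- by apply/fintype.subsetP => i; rewrite inE; exact/implyP.
- rewrite -(delta_column_sparsity factors j w); apply/eqP; congr (#|pred_of_set _|).
  by apply/setP => i; rewrite !inE -bw ffunE.
- by apply/forallP => i; apply/implyP; rewrite inE.
Qed.

Lemma sjlt_sparse_mask_law : sparse_mask_law s delta_law.
Proof.
split; [exact: delta_law_ge0|exact: delta_law_sum1|move=> K S].
pose in_S j (b : mask) := [forall i, b (i, j) ==> (i \in S)].
pose A j := [set w | in_S j (delta_mask w)].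
have AE j : A j =
    [set w | forall i, (if i \in S then setT else delta i j @^-1` [set 0]) w].
  apply/seteqP; split=> w /= => [/forallP wS i|wS].
    have := wS i; case: ifPn => //= iS; rewrite implybF delta_mask_nat.
    by move=> /negbTE ->.
  apply/forallP => i; have := wS i; case: ifPn => //= iS; rewrite ?implybT//.
  by rewrite delta_mask_nat implybF => /eqP; rewrite pnatr_eq0 eqb0.
have A_event j : sigma_algebra_of (fun i => delta i j) (A j).
  rewrite AE; apply: sigma_algebra_of_forall => i; case: ifP => _.
    exact: sigma_algebra_ofT.
  exact: (sigma_algebra_of_preimage (X := fun i => delta i j)).
have PA j : P (A j) = (\sum_(b | in_S j b) delta_law b)%:E.
  by have [] := probability_fintype P (in_S j) measurable_delta_mask.
have [_] := probability_fintype P (fun b : mask => [forall j in K, in_S j b])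
  measurable_delta_mask.
have -> : [set w | [forall j in K, in_S j (delta_mask w)]] =
    \bigcap_(j in [set` K]) A j.
  apply/seteqP; split=> w /=.
    by move=> /forallP wK j jK; have /implyP := wK j; exact.
  by move=> wK; apply/forallP => j; apply/implyP => jK; exact: wK.
rewrite (delta_columns_indep factors) => [|j _]; last exact: A_event.
rewrite (eq_bigr _ (fun j _ => PA j)) -(big_morph EFin EFinM erefl) => -[<-].
rewrite -prodr_const; apply: ler_prod => j _; rewrite delta_law_column.
by rewrite sumr_ge0// => b _; exact: delta_law_ge0.
Qed.

End SjltLaw.

(** * Nets and sparse roundings *)

Section Discretization.
Context {R : realType}.

Lemma l2ball_net d (H : nat) : (0 < H)%N ->
  exists rep : {ffun 'I_d -> 'I_(2 * H).+1} -> 'cV[R]_d,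
    (forall c, l2ball R d (rep c)) /\
    forall x, l2ball R d x -> exists c, forall i, `|(x - rep c) i 0| <= H%:R^-1.
Proof.
move=> H0; have H0' : 0 < H%:R :> R by rewrite ltr0n.
pose cell (x : 'cV[R]_d) : {ffun 'I_d -> 'I_(2 * H).+1} :=
  [ffun i => inord (Num.truncn ((x i 0 + 1) * H%:R))].
have /choice[rep repP] : forall c, exists y, l2ball R d y /\
    ((exists2 x, l2ball R d x & cell x = c) -> cell y = c).
  move=> c; have [[x Bx xc]|nx] := pselect (exists2 x, l2ball R d x & cell x = c).
    by exists x.
  by exists 0; split => //; rewrite /l2ball/= l2norm0.
exists rep; split => [c|x Bx]; first by have [] := repP c.
exists (cell x) => i; have [Br rep_cell] := repP (cell x).
have cell_itv y : l2ball R d y ->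
    (cell y i)%:R <= (y i 0 + 1) * H%:R < (cell y i)%:R + 1.
  move=> By; have := le_trans (ler_coord_l2norm y i) By.
  rewrite ler_norml => /andP[y1 y2].
  have y0 : 0 <= (y i 0 + 1) * H%:R by rewrite mulr_ge0//; lra.
  have /andP[t1 t2] := truncn_itv y0.
  rewrite ffunE inordK; first by rewrite t1 natr1.
  rewrite ltnS -(ler_nat R) (le_trans t1)// natrM ler_wpM2r//; lra.
have := cell_itv _ Br; rewrite rep_cell; last by exists x.
have := cell_itv _ Bx => /andP[x1 x2] /andP[r1 r2].
rewrite -(ler_pM2r H0') mulVf ?gt_eqF// -[X in _ * X](gtr0_norm H0') -normrM !mxE.
by rewrite ler_norml; apply/andP; split; lra.
Qed.

Definition digit (Q : nat) (e : 'I_(2 * Q).+1) : R := e%:R - Q%:R.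

Lemma truncation_digit (Q : nat) (x : R) : `|x| <= Q%:R ->
  exists e : 'I_(2 * Q).+1, [/\ `|digit e - x| <= 1, `|x| < 1 -> digit e = 0 &
    forall k : nat, k%:R <= `|x| -> k%:R <= `|digit e|].
Proof.
move=> xQ; pose t := Num.truncn `|x|.
have /andP[tx xt] : t%:R <= `|x| < t.+1%:R by apply: truncn_itv.
have tQ : (t <= Q)%N by rewrite -(ler_nat R) (le_trans tx).
have t_eq0 : `|x| < 1 -> t = 0%N.
  by move=> x1; apply/eqP; rewrite -leqn0 -ltnS -(ltr_nat R) (le_lt_trans tx).
have t_ge (k : nat) : k%:R <= `|x| -> (k <= t)%N.
  by move=> kx; rewrite -ltnS -(ltr_nat R) (le_lt_trans kx).
rewrite -natr1 in xt; rewrite /digit; have [x0|x0] := leP 0 x.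
  have Qt : (Q + t < (2 * Q).+1)%N by lia.
  have dE : (Q + t)%:R - Q%:R = t%:R :> R by rewrite natrD addrAC subrr add0r.
  exists (Ordinal Qt); rewrite /= dE.
  rewrite (ger0_norm x0) in tx xt; split=> [|/t_eq0 ->//|k /t_ge].
    by rewrite ler0_norm; lra.
  by rewrite ger0_norm// ler_nat.
have Qt : (Q - t < (2 * Q).+1)%N by lia.
have dE : (Q - t)%:R - Q%:R = - t%:R :> R by rewrite natrB// addrAC subrr add0r.
exists (Ordinal Qt); rewrite /= dE.
rewrite (ltr0_norm x0) in tx xt; split=> [|/t_eq0 ->|k /t_ge].
- by rewrite ler_norml; apply/andP; split; lra.
- by rewrite oppr0.
- by rewrite normrN ger0_norm// ler_nat.
Qed.

Variable n : nat.
Implicit Types v : 'cV[R]_n.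

Definition sparse_vector k Q (p : {ffun 'I_k -> 'I_n * 'I_(2 * Q).+1}) : 'cV[R]_n :=
  \col_i if [pick t | (p t).1 == i] is Some t then digit (p t).2 else 0.

Lemma sparse_vector_digits k Q (z : 'I_n -> 'I_(2 * Q).+1) : (0 < n)%N -> (0 < k)%N ->
  (#|[set i | (digit (z i) != 0)%R]%SET| <= k)%N ->
  exists p : {ffun 'I_k -> 'I_n * 'I_(2 * Q).+1},
    forall i, sparse_vector p i 0 = digit (z i).
Proof.
move=> n0 k0 zk; set S := finset _ in zk.
pose f (t : 'I_k) := nth (Ordinal n0) (enum S) t.
exists [ffun t => (f t, z (f t))] => i; rewrite mxE.
case: pickP => [t|not_listed]; first by rewrite ffunE/= => /eqP ->.
apply/esym/eqP/negPn/negP => zi.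
have iS : i \in enum S by rewrite mem_enum inE.
have ik : (index i (enum S) < k)%N.
  by apply: leq_trans zk; rewrite cardE index_mem.
by have := not_listed (Ordinal ik); rewrite ffunE/= /f/= nth_index// eqxx.
Qed.

Lemma sparse_rounding k Q v : (0 < n)%N -> (0 < k)%N ->
  (forall i, `|v i 0| <= Q%:R) -> (#|large_coords v 1| <= k)%N ->
  exists p : {ffun 'I_k -> 'I_n * 'I_(2 * Q).+1},
    (forall i, `|(sparse_vector p - v) i 0| <= 1) /\
    forall h : nat, large_coords v h%:R \subset large_coords (sparse_vector p) h%:R.
Proof.
move=> n0 k0 vQ vk.
have /choice[z zP] := fun i => truncation_digit (vQ i).
have [|p pE] := @sparse_vector_digits k Q z n0 k0.
  apply: leq_trans vk; apply/subset_leq_card/fintype.subsetP => i; rewrite !inE.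
  by apply: contraR; rewrite -ltNge; have [_ vi0 _] := zP i => /vi0 ->.
exists p; split=> [i|h].
  by have [+ _ _] := zP i; rewrite !mxE -pE mxE.
by apply/fintype.subsetP => i; rewrite !inE pE; have [_ _] := zP i; exact.
Qed.

Lemma large_coordsZ a v t : 0 < a -> large_coords (a *: v) t = large_coords v (t / a).
Proof.
by move=> a0; apply/setP => i; rewrite !inE mxE normrM gtr0_norm// ler_pdivrMr// mulrC.
Qed.

Lemma large_coordsS v t t' : t' <= t -> large_coords v t \subset large_coords v t'.
Proof. by move=> tt'; apply/fintype.subsetP => i; rewrite !inE; exact: le_trans. Qed.

Lemma large_coords_perturb v w t e : (forall i, `|(w - v) i 0| <= e) ->
  large_coords v t \subset large_coords w (t - e).
Proof.
move=> vw; apply/fintype.subsetP => i; rewrite !inE lerBlDr => /le_trans; apply.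
rewrite -{1}(subrK (w i 0) (v i 0)) addrC; apply: le_trans (ler_normD _ _) _.
by rewrite lerD2l distrC; have := vw i; rewrite !mxE.
Qed.

Lemma dyadic_levels (N : nat -> nat) J : (0 < N 0)%N ->
  (exists2 j, (j < J)%N & (2 ^ j <= N j)%N /\ (N j.+1 < 2 ^ j.+1)%N) \/
  (2 ^ J <= N J)%N.
Proof.
move=> N0; elim: J => [|J [[j jJ Nj]|NJ]]; first by right.
  by left; exists j => //; rewrite ltnS ltnW.
by have [NJ1|NJ1] := leqP (2 ^ J.+1) (N J.+1); [right|left; exists J].
Qed.

End Discretization.

(** * Union bound over the chords *)

Section BadFamilies.
Context {R : realType} {m n : nat}.
Local Notation pattern :=
  ({ffun 'I_m * 'I_n -> bool} * {ffun 'I_m * 'I_n -> bool})%type.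
Implicit Types (x : pattern) (v w : 'cV[R]_n) (rho : R).

Lemma small_rows_le v rho rho' x :
  rho <= rho' -> small_rows v rho x -> small_rows v rho' x.
Proof.
move=> rho_le /forallP small; apply/forallP => i; exact: le_trans (small i) rho_le.
Qed.

Lemma small_rows_perturb v w rho e x : (forall j, `|(w - v) j 0| <= e) ->
  small_rows v rho x -> small_rows w (n%:R * e + rho) x.
Proof.
move=> vw /forallP small; apply/forallP => i.
rewrite -(subrK v w) mulmxDr mxE (le_trans (ler_normD _ _))// lerD//.
exact: ler_pattern_matrix_coord.
Qed.

Lemma small_rowsZ a v rho x :
  0 < a -> small_rows v rho x -> small_rows (a *: v) (a * rho) x.
Proof.
move=> a0 /forallP small; apply/forallP => i.
by rewrite -scalemxAr mxE normrM gtr0_norm// ler_pM2l.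
Qed.

(* Scaling sends the level [|v| / (n + 1)^j] to [n + 1] and the next one to [1],
   so that rounding perturbs each row by at most [n]. *)
Definition bad_sparse j : pred pattern :=
  bad_family (@sparse_vector R n (2 ^ j.+1) (n.+1 ^ j.+1))
    (n%:R + 2^-1) n.+1%:R (2 ^ j).

Lemma bad_sparseP x v j : (0 < n)%N -> v != 0 ->
  (2 ^ j <= #|large_coords v (`|v| / (n.+1 ^ j)%:R)|)%N ->
  (#|large_coords v (`|v| / (n.+1 ^ j.+1)%:R)| < 2 ^ j.+1)%N ->
  small_rows v (`|v| / (2 * (n.+1 ^ j.+1)%:R)) x ->
  bad_sparse j x.
Proof.
move=> n0 v0 many few small; have nv : 0 < `|v| by rewrite normr_gt0.
set Q := (n.+1 ^ j.+1)%N in few small *.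
have Q0 : 0 < Q%:R :> R by rewrite ltr0n expn_gt0.
pose a : R := Q%:R / `|v|; have a0 : 0 < a by rewrite divr_gt0.
have [|||p [p_near p_large]] := @sparse_rounding R n (2 ^ j.+1) Q (a *: v) n0.
- by rewrite expn_gt0.
- move=> i; rewrite mxE normrM gtr0_norm// mulrAC ler_pdivrMr// ler_pM2l//.
  exact: ler_coord_norm.
- by rewrite large_coordsZ// div1r invf_div ltnW.
apply/existsP; exists p; apply/andP; split.
  apply: leq_trans (subset_leq_card (p_large n.+1)); rewrite large_coordsZ//.
  have -> : n.+1%:R / a = `|v| / (n.+1 ^ j)%:R.
    rewrite /a /Q expnS natrM; field.
    by rewrite nat1r !pnatr_eq0 expn_eq0 normr_eq0 v0.
  exact: many.
apply: small_rows_le (small_rows_perturb p_near (small_rowsZ a0 small)).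
rewrite mulr1 lerD2l le_eqVlt; apply/orP; left; apply/eqP; rewrite /a; field.
by rewrite !gt_eqF.
Qed.

Section ChordNet.
Variables (d : nat) (F : 'cV[R]_d -> 'cV[R]_n) (K delta : R).
Variables (I : finType) (rep : I -> 'cV[R]_d).
Local Notation B := (l2ball R d).
Hypothesis K_ge0 : 0 <= K.
Hypothesis lipF : forall y z, B y -> B z -> l2norm (F y - F z) <= K * l2norm (y - z).
Hypothesis repB : forall c, B (rep c).
Hypothesis rep_net : forall y, B y -> exists c, forall i, `|(y - rep c) i 0| <= delta.

Definition net_chord (c : I * I) : 'cV[R]_n := F (rep c.1) - F (rep c.2).

Definition net_error : R := 2 * K * d%:R * delta.

Lemma net_chord_approx y z : B y -> B z ->
  exists c, forall i, `|(net_chord c - (F y - F z)) i 0| <= net_error.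
Proof.
move=> By Bz; have [cy cyP] := rep_net By; have [cz czP] := rep_net Bz.
exists (cy, cz) => i.
have rep_error u c : B u -> (forall i, `|(u - rep c) i 0| <= delta) ->
    l2norm (F u - F (rep c)) <= K * (d%:R * delta).
  move=> Bu uc; apply: le_trans (lipF Bu (repB c)) _.
  by rewrite ler_wpM2l// l2norm_le_coord.
have -> : net_chord (cy, cz) - (F y - F z) = (F z - F (rep cz)) - (F y - F (rep cy)).
  by rewrite /net_chord /=; apply/colP => k; rewrite !mxE; ring.
apply: le_trans (ler_coord_l2norm _ i) _; apply: le_trans (ler_l2normB _ _) _.
have := lerD (rep_error z cz Bz czP) (rep_error y cy By cyP).
by rewrite /net_error; lra.
Qed.

Lemma bad_netP x y z t k : B y -> B z ->
  (k <= #|large_coords (F y - F z) t|)%N ->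
  small_rows (F y - F z) net_error x ->
  bad_family net_chord (n%:R * net_error + net_error) (t - net_error) k x.
Proof.
move=> By Bz large small; have [c c_near] := net_chord_approx By Bz.
apply/existsP; exists c; apply/andP; split.
  exact: leq_trans large (subset_leq_card (large_coords_perturb _ c_near)).
exact: small_rows_perturb c_near small.
Qed.

End ChordNet.

End BadFamilies.

Section UnionBoundExponents.

Definition net_resolution (a L : nat) : nat := 2 ^ ((11 + 4 * a) * L ^ 2).

(* A chord of the net has [2 d] coordinates of [(11 + 4 a) L^2 + 2] bits each. *)
Definition net_exponent (a : nat) : nat := 26 + 8 * a.

Definition sjlt_constant (a : nat) : nat := 512 * (net_exponent a + 4).

Lemma sjlt_constant_ge256 a : (256 <= sjlt_constant a)%N.
Proof. by rewrite (@leq_trans 512)// leq_pmulr// addn_gt0 orbT. Qed.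

Lemma small_ball_exponent_ge b X k d s m : (0 < s <= m)%N -> (0 < k <= 2 * d)%N ->
  (512 * (b + 4) * X <= s)%N -> (512 * (b + 4) * d * X <= m)%N ->
  ((b + 3) * (X * k) + s %/ 256 <= small_ball_exponent m s k)%N.
Proof.
move=> /andP[s0 sm] /andP[k0 kd] s_ge m_ge; rewrite /small_ball_exponent leq_divRL//.
have s_div : (s %/ 256 * 256 <= s)%N by rewrite leq_divM.
have [km|mk] := leqP k (m %/ s); rewrite mulnDl.
  have sk : (s <= s * k)%N by rewrite leq_pmulr.
  have : (512 * (b + 4) * X * k <= s * k)%N by rewrite leq_mul2r s_ge orbT.
  by rewrite -mulnA; move: (X * k)%N (s * k)%N sk => Y Z; nia.
have m_le : (m <= 2 * (s * (m %/ s)))%N.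
  have := divn_eq m s; have := ltn_pmod m s0.
  by have : (0 < m %/ s)%N by [rewrite divn_gt0]; nia.
have Xk : (X * k <= 2 * (d * X))%N by rewrite mulnA mulnC leq_mul2r kd orbT.
rewrite -mulnA in m_ge.
by move: Xk m_le m_ge; move: (X * k)%N (d * X)%N (s * (m %/ s))%N => Y Z W; nia.
Qed.

Variables (n L : nat).
Hypotheses (n_gt1 : (1 < n)%N) (nL : (n <= 2 ^ L)%N).

Let L_gt0 : (0 < L)%N.
Proof. by case: L nL => //; rewrite expn0; lia. Qed.

Let expn_double : (2 * n <= 2 ^ (2 * L))%N.
Proof. by rewrite [(2 * L)%N]mul2n -addnn expnD leq_mul//; lia. Qed.

Lemma card_sparse_vectors j : (j < L)%N ->
  (#|{ffun 'I_(2 ^ j.+1) -> 'I_n * 'I_(2 * n.+1 ^ j.+1).+1}|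
    <= 2 ^ (10 * (L ^ 2 * 2 ^ j)))%N.
Proof.
move=> jL; rewrite card_ffun card_prod !card_ord.
have QL : (n.+1 ^ j.+1 <= 2 ^ (2 * L * j.+1))%N by rewrite expnM leq_exp2r//; lia.
have Q0 : (0 < 2 ^ (2 * L * j.+1))%N by rewrite expn_gt0.
have base : (n * (2 * n.+1 ^ j.+1).+1 <= 2 ^ (L + (2 * L * j.+1 + 2)))%N.
  by rewrite expnD; apply: leq_mul => //; rewrite expnD; lia.
apply: (@leq_trans ((2 ^ (L + (2 * L * j.+1 + 2))) ^ (2 ^ j.+1))).
  by rewrite leq_exp2r// expn_gt0.
rewrite -expnM leq_exp2l// expnS.
have : (L + (2 * L * j.+1 + 2) <= 5 * L ^ 2)%N by rewrite expnS expn1; nia.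
move: (2 ^ j)%N (L ^ 2)%N => k X; nia.
Qed.

Lemma net_fineness a d J : (d <= n)%N -> (J <= L)%N ->
  (2 ^ (4 * a) * (8 * d * n ^ 2 * (n + 2) * n.+1 ^ J) < net_resolution a L)%N.
Proof.
move=> dn J_le_L.
have pow_le : (n.+1 ^ J <= 2 ^ (2 * L * L))%N.
  apply: (@leq_trans (n.+1 ^ L)); first by rewrite leq_exp2l//; lia.
  by rewrite expnM leq_exp2r//; lia.
have sqr_le : (n ^ 2 <= 2 ^ (L * 2))%N by rewrite expnM leq_exp2r.
apply: (@leq_ltn_trans (2 ^ (4 * a) *
  (2 ^ 3 * 2 ^ L * 2 ^ (L * 2) * 2 ^ (2 * L) * 2 ^ (2 * L * L)))%N).
  by do !apply: leq_mul => //; lia.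
rewrite /net_resolution -!expnD ltn_exp2l// expnS expn1; nia.
Qed.

Lemma card_net a d k : (d <= k)%N ->
  (#|{: {ffun 'I_d -> 'I_(2 * net_resolution a L).+1} *
        {ffun 'I_d -> 'I_(2 * net_resolution a L).+1}}|
    <= 2 ^ (net_exponent a * (L ^ 2 * k)))%N.
Proof.
move=> dk; rewrite card_prod !card_ffun !card_ord.
rewrite /net_resolution; set e := ((11 + 4 * a) * L ^ 2)%N.
have cells : ((2 * 2 ^ e).+1 <= 2 ^ (e + 2))%N.
  by rewrite expnD; have : (0 < 2 ^ e)%N by [rewrite expn_gt0]; lia.
have reps : ((2 * 2 ^ e).+1 ^ d <= 2 ^ ((e + 2) * d))%N.
  by rewrite expnM; case: (d) => [|d']; [rewrite !expn0|rewrite leq_exp2r].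
apply: (leq_trans (leq_mul reps reps)); rewrite -expnD leq_exp2l//.
have X0 : (0 < L ^ 2)%N by rewrite expn_gt0 L_gt0.
rewrite /e /net_exponent; move: (L ^ 2)%N X0 => X X0.
have Xdk : (X * d <= X * k)%N by rewrite leq_mul2l dk orbT.
have dX : (d <= X * k)%N by apply: leq_trans Xdk; rewrite leq_pmull.
have : (a * (X * d) <= a * (X * k))%N by rewrite leq_mul2l Xdk orbT.
lia.
Qed.

End UnionBoundExponents.

Section ChordUnionBound.
Context {R : realType}.
Variables (m n s d a L : nat) (F : 'cV[R]_d -> 'cV[R]_n).
Variable q : {ffun 'I_m * 'I_n -> bool} -> R.
Local Notation pattern :=
  ({ffun 'I_m * 'I_n -> bool} * {ffun 'I_m * 'I_n -> bool})%type.
Local Notation B := (l2ball R d).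
Local Notation c0 := ((2 ^ a)%:R : R).
Hypothesis s_m : (0 < s <= m)%N.
Hypothesis lawq : sparse_mask_law s q.
Hypothesis d_n : (0 < d <= n)%N.
Hypothesis n_gt1 : (1 < n)%N.
Hypothesis nL : (n <= 2 ^ L)%N.
Hypothesis s_ge : (sjlt_constant a * L ^ 2 <= s)%N.
Hypothesis m_ge : (sjlt_constant a * d * L ^ 2 <= m)%N.

Let L_gt0 : (0 < L)%N.
Proof. by case: L nL => //; rewrite expn0; lia. Qed.

Lemma pattern_prb_family_le (I : finType) (V : I -> 'cV[R]_n) (rho tau : R) k :
  rho < tau -> (0 < k <= 2 * d)%N ->
  (#|I| <= 2 ^ (net_exponent a * (L ^ 2 * k)))%N ->
  pattern_prb q (bad_family V rho tau k) <= 2 ^- L * 2 ^- (s %/ 256).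
Proof.
move=> rho_tau kd; set C := (net_exponent a * (L ^ 2 * k))%N => IC.
have [s0 _] := andP s_m; have [k0 _] := andP kd.
apply: le_trans (pattern_prb_bad_family s0 lawq V k rho_tau) _.
have budget := small_ball_exponent_ge s_m kd s_ge m_ge.
have LLk : (L <= L ^ 2 * k)%N by rewrite expnS expn1 -mulnA leq_pmulr// muln_gt0 L_gt0.
have exponent : (C + 1 + L + s %/ 256 <= small_ball_exponent m s k)%N.
  by apply: leq_trans budget; rewrite /C; move: (L ^ 2 * k)%N LLk => X; lia.
apply: (@le_trans _ _ (2 ^+ C * (2 * 2 ^- (C + 1 + L + s %/ 256)))).
  apply: ler_pM => //; first by rewrite -natrX ler_nat.
  by rewrite ler_wpM2l// lef_pV2 ?posrE ?exprn_gt0// ler_weXn2l// ler1n.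
rewrite !exprD expr1 le_eqVlt; apply/orP; left; apply/eqP; field.
by rewrite !expf_neq0.
Qed.

Let J := up_log 2 d.

Let expn2_J : (d <= 2 ^ J <= 2 * d)%N.
Proof.
have [d0 _] := andP d_n; rewrite up_logP//=.
have [d1|d1] := leqP d 1; first by rewrite /J (_ : d = 1%N) ?up_log1//; lia.
have /andP[+ _] := up_log_bounds (isT : (1 < 2)%N) d1; rewrite -/J.
by case: (J) => [|J'] /=; rewrite ?expn0 ?expnS; lia.
Qed.

Let J_le_L : (J <= L)%N.
Proof. by apply: up_log_min => //; have [_ /leq_trans] := andP d_n; exact. Qed.

Lemma pattern_prb_bad_sparse j : (j < J)%N ->
  pattern_prb q (bad_sparse (R := R) j) <= 2 ^- L * 2 ^- (s %/ 256).
Proof.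
move=> jJ; have [_ expn2_J_le] := andP expn2_J; apply: pattern_prb_family_le.
- by rewrite -(natr1 n); lra.
- by rewrite expn_gt0 /= (leq_trans _ expn2_J_le)// leq_exp2l// ltnW.
- apply: leq_trans (card_sparse_vectors n_gt1 nL (leq_trans jJ J_le_L)) _.
  by rewrite leq_exp2l// leq_mul2r /net_exponent; apply/orP; right; lia.
Qed.

Local Notation H := (net_resolution a L).

Hypothesis lipF : forall y z, B y -> B z -> l2norm (F y - F z) <= c0 * l2norm (y - z).
Hypothesis expF : l2expansive B c0^-1 F.

Let err : R := net_error d c0 H%:R^-1.

Definition chord_sup_min : R := (4 * c0 ^+ 3 * n%:R ^+ 2)^-1.

Let c0_gt0 : 0 < c0.
Proof. by rewrite ltr0n expn_gt0. Qed.

Let n_gt0 : 0 < n%:R :> R.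
Proof. by rewrite ltr0n ltnW. Qed.

Let chord_sup_min_gt0 : 0 < chord_sup_min.
Proof. by rewrite invr_gt0 !mulr_gt0 ?exprn_gt0. Qed.

Let coord_min : R := chord_sup_min / (n.+1 ^ J)%:R.

Section NetOfTheBall.
Variable rep : {ffun 'I_d -> 'I_(2 * H).+1} -> 'cV[R]_d.
Hypothesis repB : forall c, B (rep c).
Hypothesis rep_net : forall y, B y -> exists c, forall i, `|(y - rep c) i 0| <= H%:R^-1.

Definition bad_net : pred pattern :=
  bad_family (net_chord F rep) (n%:R * err + err) (coord_min - err) (2 ^ J).

Lemma net_error_lt : (n%:R + 2) * err < coord_min.
Proof.
have [_ dn] := andP d_n.
have H_gt0 : 0 < H%:R :> R by rewrite ltr0n expn_gt0.
have fine_net : c0 ^+ 4 * (8 * d%:R * n%:R ^+ 2 * (n%:R + 2) * (n.+1 ^ J)%:R) < H%:R.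
  rewrite -natrX -expnM [(a * 4)%N]mulnC -[n%:R + 2]natrD -!natrX -!natrM ltr_nat.
  exact: net_fineness n_gt1 nL _ _ _ dn J_le_L.
have h_gt0 : 0 < (n.+1 ^ J)%:R :> R by rewrite ltr0n expn_gt0.
rewrite /err /net_error mulrA ltr_pdivrMr// /coord_min [ltRHS]mulrAC ltr_pdivlMr//.
rewrite /chord_sup_min ltr_pdivlMl ?mulr_gt0 ?exprn_gt0//.
by apply: le_lt_trans fine_net; rewrite le_eqVlt; apply/orP; left; apply/eqP; ring.
Qed.

Lemma pattern_prb_bad_net : pattern_prb q bad_net <= 2 ^- L * 2 ^- (s %/ 256).
Proof.
have [dJ J2d] := andP expn2_J; apply: pattern_prb_family_le.
- by have := net_error_lt; lra.
- by rewrite expn_gt0.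
- exact: (card_net n_gt1 nL a dJ).
Qed.

Definition bad_patterns : pred pattern :=
  fun x => [exists o : option 'I_J,
    xpredT o && (if o is Some j then bad_sparse (R := R) j else bad_net) x].

Lemma pattern_prb_bad_patterns : pattern_prb q bad_patterns <= 2 ^- (s %/ 256).
Proof.
apply: le_trans (pattern_prb_union lawq _ _) _.
apply: (@le_trans _ _ (\sum_(o : option 'I_J) 2 ^- L * 2 ^- (s %/ 256))).
  apply: ler_sum => -[j|] _; [exact: pattern_prb_bad_sparse|exact: pattern_prb_bad_net].
rewrite sumr_const card_option card_ord -[leLHS]mulr_natl mulrA.
rewrite ler_piMl// ler_pdivrMr ?exprn_gt0// mul1r -natrX ler_nat.
by apply: leq_trans (ltn_expl L (isT : (1 < 2)%N)); rewrite ltnS.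
Qed.

Lemma chord_norm_ge y z : B y -> B z -> (4 * c0 ^+ 2 * n%:R)^-1 <= l2norm (y - z) ->
  chord_sup_min <= `|F y - F z|.
Proof.
move=> By Bz yz; have := le_trans (expF By Bz) (ler_l2norm_mx _).
rewrite -ler_pdivrMl//; apply: le_trans.
have -> : chord_sup_min = n%:R^-1 * (c0^-1 * (4 * c0 ^+ 2 * n%:R)^-1).
  by rewrite /chord_sup_min; field; rewrite !gt_eqF.
by rewrite !ler_pM2l ?invr_gt0.
Qed.

Definition chord_row_min : R := Num.min err (coord_min / 2).

Lemma chord_row_min_gt0 : 0 < chord_row_min.
Proof.
have [d_gt0 _] := andP d_n.
have err_gt0 : 0 < err by rewrite /err /net_error !mulr_gt0 ?invr_gt0 ?ltr0n ?expn_gt0.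
have coord_min_gt0 : 0 < coord_min by rewrite divr_gt0// ltr0n expn_gt0.
by rewrite lt_min err_gt0 divr_gt0.
Qed.

Lemma long_chord_row x y z : ~~ bad_patterns x -> B y -> B z ->
  (4 * c0 ^+ 2 * n%:R)^-1 <= l2norm (y - z) ->
  exists i, chord_row_min < `|(pattern_matrix x *m (F y - F z)) i 0|.
Proof.
move=> + By Bz yz; set v := F y - F z; apply: contraNP => /forallNP no_row.
have small : small_rows v chord_row_min x.
  by apply/forallP => i; rewrite leNgt; apply/negP.
have v_ge : chord_sup_min <= `|v| := chord_norm_ge By Bz yz.
have v_neq0 : v != 0 by rewrite -normr_gt0 (lt_le_trans _ v_ge).
have [i vi] := exists_coord_norm v_neq0.
pose N j := #|large_coords v (`|v| / (n.+1 ^ j)%:R)|.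
have N0 : (0 < N 0)%N.
  by apply/card_gt0P; exists i; rewrite inE expn0 divr1 vi.
have h_gt0 k : 0 < (n.+1 ^ k)%:R :> R by rewrite ltr0n expn_gt0.
have [[j jJ [Nj Nj1]]|NJ] := dyadic_levels J N0; apply/existsP.
  exists (Some (Ordinal jJ)) => /=; apply: bad_sparseP Nj Nj1 _ => //.
    exact: ltnW.
  apply: small_rows_le small; rewrite ge_min; apply/orP; right.
  rewrite /coord_min -mulrA -invfM; apply: ler_pM => //; first exact: ltW.
  rewrite [_ * 2]mulrC lef_pV2 ?posrE ?mulr_gt0// ler_pM2l// ler_nat.
  by rewrite leq_exp2l// ltnS ltnW.
exists None => /=; apply: (bad_netP _ lipF repB rep_net By Bz).
- exact: ltW.
- apply: leq_trans NJ (subset_leq_card (large_coordsS _ _)).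
  by rewrite ler_pM2r// invr_gt0.
by apply: small_rows_le small; rewrite ge_min lexx.
Qed.

End NetOfTheBall.

Lemma long_chords_union_bound : exists (bad : pred pattern) (kappa : R),
  [/\ 0 < kappa, pattern_prb q bad <= 2 ^- (s %/ 256) &
    forall x, ~~ bad x -> forall y z, B y -> B z ->
      (4 * c0 ^+ 2 * n%:R)^-1 <= l2norm (y - z) ->
      exists i, kappa < `|(pattern_matrix x *m (F y - F z)) i 0|].
Proof.
have [|rep [repB rep_net]] := @l2ball_net R d H; first by rewrite expn_gt0.
exists (bad_patterns rep), chord_row_min; split.
- exact: chord_row_min_gt0.
- exact: pattern_prb_bad_patterns.
- by move=> x not_bad y z; exact: (long_chord_row repB rep_net not_bad).
Qed.

End ChordUnionBound.

(** * Preservation of geodesics *)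

Section LogarithmicConstants.
Context {R : realType}.

Lemma ln2_ge_half : 2^-1 <= ln 2 :> R.
Proof.
rewrite -lerN2 -lnV ?posrE//.
have -> : 2^-1 = 1 + - 2^-1 :> R by lra.
have -> : - (1 + - 2^-1) = - 2^-1 :> R by lra.
by apply: le_ln1Dx; lra.
Qed.

Lemma up_log2_le_ln (n : nat) : (1 < n)%N -> (up_log 2 n)%:R <= 4 * ln n%:R :> R.
Proof.
move=> n1; have /andP[+ _] := up_log_bounds (isT : (1 < 2)%N) n1.
have n0 : 0 < n%:R :> R by rewrite ltr0n; lia.
have ln2n : ln 2 <= ln n%:R :> R by rewrite ler_ln ?posrE// ler_nat.
have ln2 := ln2_ge_half.
case: (up_log 2 n) => [_|l /= lt_n]; first by lra.
have l_ln2 : l%:R * ln 2 <= ln n%:R :> R.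
  rewrite mulr_natl -lnXn// -natrX ler_ln ?posrE// ?ltr0n ?expn_gt0//.
  by rewrite ler_nat ltnW.
have : l%:R * 2^-1 <= l%:R * ln 2 :> R by rewrite ler_wpM2l.
by rewrite -(natr1 l); lra.
Qed.

Lemma leq_sqr_up_log2 (n k s : nat) : (1 < n)%N ->
  16 * k%:R * ln n%:R ^+ 2 <= s%:R :> R -> (k * up_log 2 n ^ 2 <= s)%N.
Proof.
move=> n1 ks; rewrite -(ler_nat R); apply: le_trans ks.
have -> : 16 * k%:R * ln n%:R ^+ 2 = k%:R * (4 * ln n%:R) ^+ 2 :> R by ring.
rewrite natrM natrX ler_wpM2l// ler_pXn2r ?nnegrE// ?up_log2_le_ln//.
by rewrite mulr_ge0 ?ln_ge0 ?ler1n// ltnW.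
Qed.

Lemma pow2_div256_le_expR (s : nat) : (256 <= s)%N ->
  2 ^- (s %/ 256) <= expR (- (1024^-1 * s%:R)) :> R.
Proof.
move=> s256; set t := (s %/ 256)%N.
have st : (s <= 512 * t)%N.
  have := divn_eq s 256; have := ltn_pmod s (isT : (0 < 256)%N).
  have : (0 < t)%N by rewrite divn_gt0.
  rewrite -/t; lia.
have -> : 2 ^- t = expR (- (t%:R * ln 2)) :> R.
  by rewrite expRN expRM_natl lnK ?posrE.
rewrite ler_expR lerN2.
have t_ln2 : t%:R * 2^-1 <= t%:R * ln 2 :> R by rewrite ler_wpM2l// ln2_ge_half.
have : s%:R <= 512 * t%:R :> R by rewrite -natrM ler_nat.
lra.
Qed.

End LogarithmicConstants.

Section SjltMatrix.
Context {R : realType} {disp : measure_display} {T : measurableType disp}.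
Variables (P : probability T R) (m n s : nat).
Variables sigma delta : 'I_m -> 'I_n -> {RV P >-> R}.
Hypothesis factors : sjlt_factors s sigma delta.
Hypothesis s_gt0 : (0 < s)%N.
Variable Phi : T -> 'M[R]_(m, n).
Hypothesis PhiE :
  forall w i j, Phi w i j = (Num.sqrt s%:R)^-1 * sigma i j w * delta i j w.

Lemma sjlt_pattern_matrix w :
  Phi w = (Num.sqrt s%:R)^-1 *: pattern_matrix (sjlt_pattern sigma delta w).
Proof.
apply/matrixP => i j; rewrite PhiE !mxE -mulrA.
by rewrite (sign_mask_expr factors) (delta_mask_nat factors).
Qed.

Lemma sjlt_probability_ge (bad : pred ({ffun 'I_m * 'I_n -> bool} * _))
    (good : 'M[R]_(m, n) -> Prop) :
  (forall w, ~~ bad (sjlt_pattern sigma delta w) -> good (Phi w)) ->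
  ((1 - pattern_prb (delta_law delta) bad)%:E <= P [set w | good (Phi w)])%E.
Proof.
move=> bad_good; pose pattern w := sjlt_pattern sigma delta w.
have [mbad Pbad] := probability_sjlt_pattern factors bad.
have [mgood _] := probability_sjlt_pattern factors
  (fun x => `[< good ((Num.sqrt s%:R)^-1 *: pattern_matrix x) >]).
have goodE : [set w | good (Phi w)] =
    [set w | `[< good ((Num.sqrt s%:R)^-1 *: pattern_matrix (pattern w)) >]].
  by apply/seteqP; split => w /=; rewrite sjlt_pattern_matrix => /asboolP.
rewrite EFinB -Pbad -probability_setC//; apply: le_measure; rewrite ?inE.
- exact: measurableC.
- by rewrite goodE.
- by move=> w /negP; exact: bad_good.
Qed.

Lemma l2norm_sjlt_col w j : l2norm (col j (Phi w)) = 1.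
Proof.
apply/eqP; rewrite -(eqrXn2 (n := 2)) ?l2norm_ge0// sqr_l2norm expr1n.
rewrite (eq_bigr (fun i => if delta i j w == 1 then s%:R^-1 else 0)) => [|i _].
  rewrite -big_mkcond/= sumr_const.
  have := delta_column_sparsity factors j w; rewrite cardsE => ->.
  by rewrite -[X in X == _]mulr_natl mulfV// pnatr_eq0 -lt0n.
rewrite mxE PhiE !exprMn (sign_mask_expr factors) sqrr_sign mulr1 exprVn sqr_sqrtr//.
have [->|->] := delta_01 factors i j w; rewrite ?eqxx ?expr1n ?mulr1//.
by rewrite lt_eqF// expr0n mulr0.
Qed.

Lemma l2norm_sjlt_mulmx_le w (v : 'cV[R]_n) : l2norm (Phi w *m v) <= n%:R * l2norm v.
Proof.
apply: le_trans (ler_l2norm_mulmx _ _) _.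
by under eq_bigr do rewrite l2norm_sjlt_col; rewrite sumr_const card_ord.
Qed.

Lemma sjlt_sparsity_le : (0 < n)%N -> (s <= m)%N.
Proof.
move=> n0; rewrite -(delta_column_sparsity factors (Ordinal n0) point).
by rewrite -[leqRHS]card_ord max_card.
Qed.

End SjltMatrix.

Lemma l2norm_mulmx_single_col (R : realType) (m n : nat) (A : 'M[R]_(m, n)) v j :
  n = 1%N -> l2norm (A *m v) = l2norm (col j A) * l2norm v.
Proof.
move=> n1; subst n.
rewrite (ord1 j) [in LHS](mx11_scalar v) mul_mx_scalar l2normZ mulrC.
have -> : col 0 A = A by apply/colP => i; rewrite mxE.
by rewrite [l2norm v]/l2norm big_ord1 sqrtr_sqr.
Qed.

Section SjltGeodesics.
Context {R : realType} {disp : measure_display} {T : measurableType disp}.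
Variables (P : probability T R) (d m n s a : nat) (c0 lo hi : R).
Variables (F : 'cV[R]_d -> 'cV[R]_n) (Phi : T -> 'M[R]_(m, n)).
Local Notation B := (l2ball R d).
Local Notation C0 := ((2 ^ a)%:R : R).
Hypothesis c0_gt0 : 0 < c0.
Hypothesis c0_le : c0 <= C0.
Hypothesis C1F : C1_on B F.
Hypothesis bilipF : forall x y, B x -> B y ->
  c0^-1 * l2norm (x - y) <= l2norm (F x - F y) <= c0 * l2norm (x - y).
Hypothesis diffF_lipschitz : forall x y, B x -> B y ->
  l2opnorm (fun v => 'd F x v - 'd F y v) <= c0 * l2norm (x - y).
Hypothesis lo_ge_half : 2^-1 <= lo.
Hypothesis hi_gt0 : 0 < hi.
Hypothesis sjltPhi : sjlt P s Phi.
Hypothesis s_gt0 : (0 < s)%N.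

Let C0_gt0 : 0 < C0. Proof. exact: lt_le_trans c0_le. Qed.

Let C0V_gt0 : 0 < C0^-1. Proof. by rewrite invr_gt0. Qed.

Let lo_gt0 : 0 < lo. Proof. by rewrite (lt_le_trans _ lo_ge_half). Qed.

Let expF : l2expansive B C0^-1 F.
Proof.
move=> x y Bx By; have /andP[+ _] := bilipF Bx By; apply: le_trans.
by rewrite ler_wpM2r ?l2norm_ge0// lef_pV2.
Qed.

Let lipF y z : B y -> B z -> l2norm (F y - F z) <= C0 * l2norm (y - z).
Proof.
move=> By Bz; have /andP[_ lipyz] := bilipF By Bz; apply: le_trans lipyz _.
by rewrite ler_wpM2r ?l2norm_ge0.
Qed.

Let diffF_C0_lipschitz y z : B y -> B z ->
  l2opnorm (fun v => 'd F y v - 'd F z v) <= C0 * l2norm (y - z).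
Proof.
move=> By Bz; apply: le_trans (diffF_lipschitz By Bz) _.
by rewrite ler_wpM2r ?l2norm_ge0.
Qed.

Let d_le_n : (d <= n)%N.
Proof.
apply: (l2expansive_leq_dim C0V_gt0 (f := 'd F 0)) => v.
apply: (l2expansive_diff _ (@l2ball_closure_interior R d) expF C1F).
by rewrite /l2ball/= l2norm0.
Qed.

Lemma preserves_geodesics_low_dim w : (d == 0)%N || (n == 1)%N ->
  preserves_geodesics F (Phi w) lo hi.
Proof.
move=> dn.
apply: (l2expansive_preserves_geodesics C1F C0V_gt0 expF lo_gt0 hi_gt0 C0V_gt0).
have [sigma [delta [factors PhiE]]] := sjltPhi.
move=> x y Bx By; have [d0|d0] := eqVneq d 0%N.
  rewrite (_ : x - y = 0) ?l2norm0 ?mulr0 ?l2norm_ge0//.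
  by apply/colP => i; exfalso; case: i => i; rewrite d0.
move: dn; rewrite (negbTE d0) /= => /eqP n1; have n_gt0 : (0 < n)%N by rewrite n1.
rewrite -mulmxBr (l2norm_mulmx_single_col _ _ (Ordinal n_gt0) n1).
by rewrite (l2norm_sjlt_col factors s_gt0 PhiE) mul1r; exact: expF.
Qed.

Lemma sjlt_preserves_geodesics L : (0 < d)%N -> (1 < n)%N -> (n <= 2 ^ L)%N ->
  (sjlt_constant a * L ^ 2 <= s)%N ->
  (sjlt_constant a * d * L ^ 2 <= m)%N ->
  ((1 - 2 ^- (s %/ 256))%:E <= P [set w | preserves_geodesics F (Phi w) lo hi])%E.
Proof.
move=> d_gt0 n_gt1 nL s_ge m_ge.
have d_n : (0 < d <= n)%N by rewrite d_gt0 d_le_n.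
have n_gt0 : 0 < n%:R :> R by rewrite ltr0n ltnW.
have [sigma [delta [factors PhiE]]] := sjltPhi.
have s_m : (0 < s <= m)%N by rewrite s_gt0 (sjlt_sparsity_le factors)// ltnW.
have [bad [kappa [kappa_gt0 pbad row_ge]]] := long_chords_union_bound s_m
  (sjlt_sparse_mask_law factors) d_n n_gt1 nL s_ge m_ge lipF expF.
apply: (@le_trans _ _ (1 - pattern_prb (delta_law delta) bad)%:E).
  by rewrite lee_fin lerD2l lerN2.
apply: (sjlt_probability_ge factors PhiE
  (good := fun A => preserves_geodesics F A lo hi)).
move=> w not_bad; have rs_gt0 : 0 < (Num.sqrt s%:R)^-1 :> R.
  by rewrite invr_gt0 sqrtr_gt0 ltr0n.
apply: (long_chords_preserve_geodesics C1F C0V_gt0 expF (ltW C0_gt0)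
  diffF_C0_lipschitz lo_gt0 hi_gt0 (ler0n _ _)
  (l2norm_sjlt_mulmx_le factors s_gt0 PhiE w)
  (r := (4 * C0 ^+ 2 * n%:R)^-1) (kappa := (Num.sqrt s%:R)^-1 * kappa)).
- have -> : n%:R * C0 * (4 * C0 ^+ 2 * n%:R)^-1 = 2^-1 * C0^-1 / 2.
    by field; rewrite !gt_eqF.
  by rewrite !ler_pM2r ?invr_gt0.
- exact: mulr_gt0.
move=> y z By Bz yz; have [i row_i] := row_ge _ not_bad y z By Bz yz.
rewrite -mulmxBr (sjlt_pattern_matrix factors PhiE) -scalemxAl l2normZ.
rewrite gtr0_norm// ler_pM2l// (le_trans (ltW row_i))//.
exact: ler_coord_l2norm.
Qed.

Lemma sjlt_preserves_geodesics_ln :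
  16 * (sjlt_constant a)%:R * d%:R * ln n%:R ^+ 2 <= m%:R :> R ->
  16 * (sjlt_constant a)%:R * ln n%:R ^+ 2 <= s%:R :> R ->
  ((1 - expR (- (1024^-1 * s%:R)))%:E
    <= P [set w | preserves_geodesics F (Phi w) lo hi])%E.
Proof.
move=> m_ge s_ge.
have [low|] := boolP ((d == 0)%N || (n == 1)%N).
  rewrite (_ : [set w | _] = setT) ?probability_setT ?lee_fin ?gerBl ?expR_ge0//.
  by apply/seteqP; split => // w _; exact: preserves_geodesics_low_dim.
rewrite negb_or -lt0n => /andP[d_gt0 n1].
have n_gt1 : (1 < n)%N by rewrite ltn_neqAle eq_sym n1 (leq_trans d_gt0).
have s_geN := leq_sqr_up_log2 n_gt1 s_ge.
have m_geN : (sjlt_constant a * d * up_log 2 n ^ 2 <= m)%N.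
  by apply: (leq_sqr_up_log2 (R := R) n_gt1); rewrite natrM mulrA.
apply: le_trans (sjlt_preserves_geodesics d_gt0 n_gt1 (up_logP n _) s_geN m_geN) => //.
rewrite lee_fin lerD2l lerN2 pow2_div256_le_expR//; apply: leq_trans s_geN.
have log_gt0 : (0 < up_log 2 n)%N by rewrite up_log_gt0 n_gt1.
by apply: leq_trans (sjlt_constant_ge256 a) _; rewrite leq_pmulr// expn_gt0 log_gt0.
Qed.

End SjltGeodesics.

Theorem theorem8p8 (R : realType) (c0 : R) (hc0 : 1 <= c0) :
  exists C c : R, 0 < C /\ 0 < c /\
  forall (d n m s : nat) (F : 'cV[R]_d -> 'cV[R]_n) (eps : R)
    (disp : measure_display) (T : measurableType disp) (P : probability T R)
    (Phi : T -> 'M[R]_(m, n)),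
  let B := l2ball R d in
  let M := F @` B in
  smooth_on B F ->
  (forall x y, B x -> B y ->
     c0^-1 * l2norm (x - y) <= l2norm (F x - F y) <= c0 * l2norm (x - y)) ->
  (forall x y, B x -> B y ->
     l2opnorm (fun v => 'd F x v - 'd F y v) <= c0 * l2norm (x - y)) ->
  0 < eps < 2^-1 ->
  sjlt P s Phi ->
  C * d%:R * (ln n%:R) ^+ 2 <= m%:R ->
  C * (ln n%:R) ^+ 2 <= s%:R ->
  ((1 - expR (- (c * s%:R)))%:E <=
   P [set w : T |
       (forall v, unit_tangent F v ->
          (1 - eps <= l2norm (Phi w *m v) <= 1 + eps)%R) ->
       forall x y, M x -> M y ->
         (1 - eps)%:E * geodesic_dist M x y
           <= geodesic_dist (mulmx (Phi w) @` M) (Phi w *m x) (Phi w *m y)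
           <= (1 + eps)%:E * geodesic_dist M x y])%E.
Proof.
have [a c0a] : exists a : nat, c0 <= (2 ^ a)%:R.
  exists (Num.truncn c0).+1; apply: le_trans (ltW (truncnS_gt c0)) _.
  by rewrite ler_nat ltnW// ltn_expl.
exists (16 * (sjlt_constant a)%:R), 1024^-1.
split; first by rewrite mulr_gt0// ltr0n (leq_trans _ (sjlt_constant_ge256 a)).
split; first by rewrite invr_gt0 ltr0n.
move=> d n m s F eps disp T P Phi B M smF bilipF diffF_lipschitz.
move=> /andP[eps_gt0 eps_lt] sjltPhi m_ge s_ge.
have [->|s_gt0] := posnP s; first by rewrite mulr0 oppr0 expR0 subrr measure_ge0.
apply: (sjlt_preserves_geodesics_ln (lt_le_trans ltr01 hc0) c0a (smooth_on_C1 smF)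
  bilipF diffF_lipschitz _ _ sjltPhi s_gt0 m_ge s_ge); lra.
Qed.
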